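(* Let $\{X_i,D_i\}$ be i.i.d. with $X_i\in\mathbb R^p$ and $D_i\in\{0,1\}$. Suppose that, conditional on the realizations of the treatment and covariates, $Y_i=f(X_i,D_i)+u_i$ with $u_i$ mutually independent and $u_i\sim N(0,\sigma^2(X_i,D_i))$. Suppose that the marginal probability that $D_i=1$ is not equal to zero or one and that $X_i$ has a bounded density conditional on $D_i$. Given $\gamma>0$ and $C>0$, let $[\hat c_n,\infty)$ be a sequence of confidence intervals for $Lf=\frac1n\sum_{i=1}^n[f(X_i,1)-f(X_i,0)]$ with asymptotic coverage at least $1-\alpha$ under $\Sigma(\gamma,C)$ conditional on $\{X_i,D_i\}_{i=1}^n$: $$\liminf_{n\to\infty}\ \inf_{f(\cdot,0),f(\cdot,1)\in\Sigma(\gamma,C)}P_f\big(Lf\in[\hat c_n,\infty)\mid\{X_i,D_i\}_{i=1}^n\big)\ge1-\alpha\quad\text{almost surely.}$$ Then, under the zero function $f(x,d)=0$ (for which $Lf=0$), $\hat c_n$ cannot converge to $Lf=0$ more quickly than $n^{-\gamma/p}$: there exists $\eta>0$ such that $$\liminf_{n\to\infty}P_0\big(\hat c_n\le-\eta n^{-\gamma/p}\mid\{X_i,D_i\}_{i=1}^n\big)\ge1-\alpha\quad\text{almost surely.}$$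
   Context: $\hat c_n$ is a function of the data $\{Y_i,X_i,D_i\}_{i=1}^n$; $P_f$ denotes probability when the regression function is $f:\mathbb R^p\times\{0,1\}\to\mathbb R$, and $P_0$ probability under $f\equiv0$. $\alpha\in(0,1)$. $\Sigma(\gamma,C)$ denotes the set of $\ell$-times differentiable functions $f:\mathbb R^p\to\mathbb R$, where $\ell$ is the greatest integer strictly less than $\gamma$, such that for all nonnegative integers $k_1,\dots,k_p$ with $\sum_{j=1}^pk_j=\ell$ and all $x,x'$, $$\left|\frac{\partial^\ell f(x)}{\partial x_1^{k_1}\cdots\partial x_p^{k_p}}-\frac{\partial^\ell f(x')}{\partial x_1^{k_1}\cdots\partial x_p^{k_p}}\right|\le C\|x-x'\|^{\gamma-\ell},$$ with $\|x\|^2=\sum_{j=1}^px_j^2$. *)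

(* Defs.v *)
From HB Require Import structures.
From mathcomp Require Import all_boot all_order all_algebra.
From mathcomp Require Import all_classical all_reals all_analysis.

Set Implicit Arguments.
Unset Strict Implicit.
Unset Printing Implicit Defensive.

Import Order.TTheory GRing.Theory Num.Theory.
Import numFieldNormedType.Exports.

Local Open Scope classical_set_scope.
Local Open Scope ring_scope.

(* Random points of R^p live in [p.-tuple R], on which the library puts the
   product sigma-algebra; differential calculus is done on ['rV[R]_p]. *)
Definition row_of_tuple (R : realType) (p : nat) (x : p.-tuple R) : 'rV[R]_p :=
  \row_j tnth x j.

Section lebesgue_tuple.
Context (R : realType).
Local Open Scope ereal_scope.

(* [lebesgue_measure] is declared on the alias [measurableTypeR R]; this is the
   same function, with its measure structure on the type [R] itself. *)
Definition lebesgueR : set R -> \bar R := @lebesgue_measure R.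

Let lebesgueR_ge0 A : 0 <= lebesgueR A.
Proof. exact: (measure_ge0 (@lebesgue_measure R)). Qed.

Let lebesgueR_sigma_additive : semi_sigma_additive lebesgueR.
Proof. exact: (@measure_semi_sigma_additive _ _ _ (@lebesgue_measure R)). Qed.

HB.instance Definition _ := isMeasure.Build _ _ _ lebesgueR
  (measure0 (@lebesgue_measure R)) lebesgueR_ge0 lebesgueR_sigma_additive.

Let lebesgueR_sigma_finite : sigma_finite setT lebesgueR.
Proof. exact: (sigma_finiteT (@lebesgue_measure R)). Qed.

HB.instance Definition _ := Measure_isSigmaFinite.Build _ _ _ lebesgueR
  lebesgueR_sigma_finite.

Definition cons_pair (p : nat) (xy : R * p.-tuple R) : p.+1.-tuple R :=
  [tuple of xy.1 :: xy.2].

Lemma measurable_cons_pair (p : nat) : measurable_fun setT (@cons_pair p).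
Proof. exact: measurable_cons. Qed.

Section cons_lebesgue.
Variables (p : nat) (m : {sigma_finite_measure set (p.-tuple R) -> \bar R}).

Definition cons_lebesgue : set (p.+1.-tuple R) -> \bar R :=
  pushforward (lebesgueR \x m) (@cons_pair p).

Let cons_lebesgue0 : cons_lebesgue set0 = 0.
Proof. by rewrite /cons_lebesgue /pushforward preimage_set0 measure0. Qed.

Let cons_lebesgue_ge0 A : 0 <= cons_lebesgue A.
Proof. by apply: integral_ge0 => x _ /=; exact: measure_ge0. Qed.

Let cons_lebesgue_sigma_additive : semi_sigma_additive cons_lebesgue.
Proof.
have mcons A : measurable A -> measurable (@cons_pair p @^-1` A).
  by move=> mA; rewrite -[X in measurable X]setTI; exact: measurable_cons_pair.
move=> F mF tF mUF; rewrite /cons_lebesgue /pushforward preimage_bigcup.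
pose mu : {measure set (R * p.-tuple R) -> \bar R} := lebesgueR \x m.
apply: (@measure_semi_sigma_additive _ _ _ mu) => [n||].
- exact: (mcons _ (mF n)).
- apply/trivIsetP => /= i j _ _ ij; rewrite -preimage_setI.
  by move/trivIsetP : tF => /(_ _ _ _ _ ij) ->//; rewrite preimage_set0.
- by rewrite -preimage_bigcup; exact: mcons.
Qed.

HB.instance Definition _ := isMeasure.Build _ _ _ cons_lebesgue
  cons_lebesgue0 cons_lebesgue_ge0 cons_lebesgue_sigma_additive.

Let cons_lebesgue_sigma_finite : sigma_finite setT cons_lebesgue.
Proof.
have /sigma_finiteP[F [TF ndF Foo]] := sigma_finiteT lebesgueR.
have /sigma_finiteP[G [TG ndG Goo]] := sigma_finiteT m.
exists (fun n => [set t | F n (thead t) /\ G n [tuple of behead t]]).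
  apply/seteqP; split=> // t _.
  have [n _ Fn] : (\bigcup_n F n) (thead t) by rewrite -TF.
  have [k _ Gk] : (\bigcup_n G n) [tuple of behead t] by rewrite -TG.
  exists (maxn n k) => //=; split.
    by apply: (subsetPset _ _ (ndF _ _ (leq_maxl n k))).
  by apply: (subsetPset _ _ (ndG _ _ (leq_maxr n k))).
move=> n; have [mF Fn] := Foo n; have [mG Gn] := Goo n; split.
  apply: measurableI.
    by rewrite -[X in measurable X]setTI; exact: (measurable_tnth ord0).
  by rewrite -[X in measurable X]setTI; exact: measurable_behead.
rewrite /cons_lebesgue /pushforward (_ : _ @^-1` _ = F n `*` G n).
  by rewrite product_measure1E// lte_mul_pinfty// ge0_fin_numE.
apply/funext => -[x y]; rewrite /preimage/= theadE /setX/=.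
by congr (_ /\ G n _); exact/val_inj.
Qed.

HB.instance Definition _ := Measure_isSigmaFinite.Build _ _ _ cons_lebesgue
  cons_lebesgue_sigma_finite.

End cons_lebesgue.

Fixpoint lebesgue_tuple (p : nat) :
    {sigma_finite_measure set (p.-tuple R) -> \bar R} :=
  match p with
  | 0 => dirac ([tuple] : 0.-tuple R)
  | p'.+1 => cons_lebesgue (lebesgue_tuple p')
  end.

Lemma lebesgue_tuple_box (p : nat) (A : 'I_p -> set R) :
  (forall j, measurable (A j)) ->
  lebesgue_tuple p [set x | forall j, A j (tnth x j)] =
  \prod_(j < p) lebesgueR (A j).
Proof.
elim: p A => [|p IH] A mA /=.
  rewrite big_ord0 diracE mem_set//.
  by case.
rewrite /cons_lebesgue /pushforward big_ord_recl -IH; last by move=> j; exact.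
rewrite -product_measure1E//=; last first.
  rewrite (_ : [set _ | _] = \bigcap_(j in [set: 'I_p])
      ((fun x : p.-tuple R => tnth x j) @^-1` A (lift ord0 j))); last first.
    by apply/seteqP; split=> x /= h j *; exact: h.
  apply: fin_bigcap_measurable => // j _.
  by rewrite -[X in measurable X]setTI; exact: measurable_tnth.
congr product_measure1; apply/seteqP; split=> -[x y] /=.
  move=> h; split; first exact: (h ord0).
  by move=> j; have := h (lift ord0 j); rewrite tnthS.
move=> [h0 h] j; case: (unliftP ord0 j) => [i ->|->]; last exact: h0.
by rewrite tnthS; exact: h.
Qed.

End lebesgue_tuple.

Section hoelder_class.
Context (R : realType) (p : nat).
Implicit Types f : 'rV[R]_p -> R.

(* The library norm on ['rV[R]_p] is the sup norm. *)
Definition enorm (x : 'rV[R]_p) : R := Num.sqrt (\sum_j x ord0 j ^+ 2).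

Definition partial (j : 'I_p) f : 'rV[R]_p -> R :=
  fun x => 'D_(delta_mx ord0 j) f x.

(* d^{|k|} f / (dx_1^{k_1} ... dx_p^{k_p}), the derivatives in x_p being taken
   first. *)
Definition mixed_partial (k : 'I_p -> nat) f : 'rV[R]_p -> R :=
  foldr (fun j g => iter (k j) (partial j) g) f (enum 'I_p).

Fixpoint times_differentiable (l : nat) f : Prop :=
  match l with
  | 0 => True
  | l'.+1 => (forall x, differentiable f x) /\
             (forall j, times_differentiable l' (partial j f))
  end.

Definition lt_floor (gamma : R) : nat := `|Num.ceil gamma - 1|%N.

Lemma lt_floorP (gamma : R) : 0 < gamma ->
  (lt_floor gamma)%:R < gamma /\
  (forall m : nat, m%:R < gamma -> (m <= lt_floor gamma)%N).
Proof.
move=> gamma0; have ceil0 : 0 < Num.ceil gamma by rewrite ceil_gt0.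
have lE : (lt_floor gamma)%:Z = Num.ceil gamma - 1.
  by rewrite /lt_floor gez0_abs// subr_ge0 -gtz0_ge1.
split=> [|m mg]; last first.
  by rewrite -lez_nat lE lerBrDr lezD1 -(ltr_int R) (lt_le_trans mg)// ceil_ge.
rewrite -[ltLHS]/(lt_floor gamma)%:Z%:~R lE.
by have /andP[] := ceil_itv gamma.
Qed.

Definition hoelder_class (gamma C : R) f : Prop :=
  times_differentiable (lt_floor gamma) f /\
  forall k : 'I_p -> nat, (\sum_j k j)%N = lt_floor gamma ->
  forall x x' : 'rV[R]_p,
    `|mixed_partial k f x - mixed_partial k f x'|
      <= C * enorm (x - x') `^ (gamma - (lt_floor gamma)%:R).

End hoelder_class.

Section independence.
Context d (T : measurableType d) (R : realType) (P : set T -> \bar R).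
Context d' (E : measurableType d').

Definition mutually_independent (I : eqType) (Z : I -> T -> E) : Prop :=
  forall (J : seq I) (A : I -> set E), uniq J ->
    (forall j, measurable (A j)) ->
    P (\bigcap_(j in [set` J]) Z j @^-1` A j) =
    (\prod_(j <- J) P (Z j @^-1` A j))%E.

Definition iid (Z : nat -> T -> E) : Prop :=
  mutually_independent Z /\
  forall (i j : nat) (A : set E), measurable A ->
    P (Z i @^-1` A) = P (Z j @^-1` A).

End independence.

(* [K z] is a regular version of the conditional law of [U] given [Z = z]. *)
Definition regular_conditional_law d (T : measurableType d) (R : realType)
    (P : set T -> \bar R) d1 (E1 : measurableType d1) d2 (E2 : measurableType d2)
    (U : T -> E1) (Z : T -> E2) (K : R.-pker E2 ~> E1) : Prop :=
  forall (A : set E1) (B : set E2), measurable A -> measurable B ->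
    P (U @^-1` A `&` Z @^-1` B) = (\int[P]_(w in Z @^-1` B) K (Z w) A)%E.

Definition bounded_conditional_density d (T : measurableType d) (R : realType)
    (P : set T -> \bar R) (p : nat) (X : T -> p.-tuple R) (D : T -> bool) : Prop :=
  forall b : bool, exists g : p.-tuple R -> R,
    [/\ measurable_fun setT g,
        (forall x, 0 <= g x),
        (exists M, forall x, g x <= M)
      & forall A, measurable A ->
          P (X @^-1` A `&` D @^-1` [set b]) =
          (P (D @^-1` [set b]) * \int[lebesgue_tuple R p]_(x in A) (g x)%:E)%E].

(* The law N(m, v); [normal_prob m 0] is not the degenerate normal law. *)
Definition normal_law (R : realType) (m v : R) : set R -> \bar R :=
  if v == 0 then \d_m else normal_prob m (Num.sqrt v).

Section model.
Context (R : realType) (p : nat).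

Implicit Types (f : 'rV[R]_p -> bool -> R) (n : nat).

Definition design (T : Type) (X : nat -> T -> p.-tuple R) (D : nat -> T -> bool)
    n (w : T) : n.-tuple (p.-tuple R * bool) :=
  [tuple (X i w, D i w) | i < n].

Definition errors (T : Type) (u : nat -> T -> R) n (w : T) : n.-tuple R :=
  [tuple u i w | i < n].

Definition at_design f n
    (z : n.-tuple (p.-tuple R * bool)) (i : 'I_n) : R :=
  f (row_of_tuple (tnth z i).1) (tnth z i).2.

Definition sample f n (z : n.-tuple (p.-tuple R * bool)) (e : n.-tuple R) :
    n.-tuple (R * (p.-tuple R * bool)) :=
  [tuple (at_design f z i + tnth e i, tnth z i) | i < n].

Definition average_effect f n (z : n.-tuple (p.-tuple R * bool)) : R :=
  n%:R^-1 * \sum_(i < n) (f (row_of_tuple (tnth z i).1) true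
                          - f (row_of_tuple (tnth z i).1) false).

Definition normal_errors n (Q : set (n.-tuple R) -> \bar R) (v : 'I_n -> R) :=
  mutually_independent Q (fun (i : 'I_n) (e : n.-tuple R) => tnth e i) /\
  forall (i : 'I_n) (A : set R), measurable A ->
    Q [set e | A (tnth e i)] = normal_law 0 (v i) A.

(* P_f(E | (X_i, D_i)_{i <= n} = z) for an event [E] on the data, [K] being the
   conditional law of the errors. *)
Definition cond_prob n
    (K : R.-pker (n.-tuple (p.-tuple R * bool)%type) ~> (n.-tuple R)) f
    (E : set (n.-tuple (R * (p.-tuple R * bool))))
    (z : n.-tuple (p.-tuple R * bool)) : \bar R :=
  K z [set e | E (sample f z e)].

End model.

(* Main.v *)
(**
  Call a sample point isolated if it is untreated and no treated point and no
  earlier point lies in the sup-norm ball of radius [2 r] around it, where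
  [r = eps n^(-1/p)].  Subtract from the zero function, at [d = 1] only, a bump
  of radius [r] and height [a r^gamma] centred at each isolated point.  The
  result [f] lies in the Hoelder class and vanishes at every [(X_i, D_i)], so the
  data have the same law under [f] as under [0], while [L f <= - a r^gamma #G / n]
  with [G] the set of isolated points.  Coverage under [f] thus gives the claim
  once [#G >= c n] for large [n], almost surely.

  The number of untreated points is bounded below by a Chernoff bound.  For the
  untreated points that are not isolated, take the union bound over the sets [S]
  they may form: as the density is bounded, a point falls into a given ball with
  probability [O(eps^p / n)], and peeling off the largest index of [S] by
  independence shows that all points of [S] fail with probability at most
  [kappa^#S], where [kappa = O(eps^p)] beats the [2^n] choices of [S].
  Borel-Cantelli concludes.
*)
Require Import Defs.
From HB Require Import structures.
From mathcomp Require Import all_boot all_order all_algebra.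
From mathcomp Require Import all_classical all_reals all_analysis.
From mathcomp Require Import measurable_realfun ring lra zify.

Set Implicit Arguments.
Unset Strict Implicit.
Unset Printing Implicit Defensive.

Import Order.TTheory GRing.Theory Num.Theory.
Import numFieldNormedType.Exports.

Local Open Scope classical_set_scope.
Local Open Scope ring_scope.

(** * A compactly supported bump and its rescalings *)

Section times_differentiable_theory.
Context (R : realType) (p : nat).
Implicit Types (f g : 'rV[R]_p -> R) (j : 'I_p) (m : nat).

Lemma times_differentiableW m f :
  times_differentiable m.+1 f -> times_differentiable m f.
Proof.
elim: m f => [//|m IH] f [df dpf]; split => // j; exact: IH.
Qed.

Lemma times_differentiable_cst m (c : R) :
  times_differentiable m (fun _ : 'rV[R]_p => c).
Proof.
elim: m c => [//|m IH] c; split => [x|j]; first exact: differentiable_cst.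
rewrite (_ : partial j _ = fun=> 0); first exact: IH.
by apply/funext => x; rewrite /partial derive_cst.
Qed.

Lemma partialD j f g : (forall x, differentiable f x) ->
  (forall x, differentiable g x) ->
  partial j (fun x => f x + g x) = fun x => partial j f x + partial j g x.
Proof.
move=> df dg; apply/funext => x; rewrite /partial.
by rewrite -[LHS]/('D__ (f + g) x) deriveD//; exact: diff_derivable.
Qed.

Lemma partialM j f g : (forall x, differentiable f x) ->
  (forall x, differentiable g x) ->
  partial j (fun x => f x * g x) =
  fun x => f x * partial j g x + g x * partial j f x.
Proof.
move=> df dg; apply/funext => x; rewrite /partial.
by rewrite -[LHS]/('D__ (f * g) x) deriveM//; exact: diff_derivable.
Qed.

Lemma times_differentiableD m f g : times_differentiable m f ->
  times_differentiable m g -> times_differentiable m (fun x => f x + g x).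
Proof.
elim: m f g => [//|m IH] f g [df dpf] [dg dpg]; split => [x|j].
  exact: differentiableD.
by rewrite partialD//; exact: (IH _ _ (dpf j) (dpg j)).
Qed.

Lemma times_differentiableM m f g : times_differentiable m f ->
  times_differentiable m g -> times_differentiable m (fun x => f x * g x).
Proof.
elim: m f g => [//|m IH] f g tf tg.
have [df dpf] := tf; have [dg dpg] := tg; split => [x|j].
  exact: differentiableM.
rewrite partialM//; apply: times_differentiableD.
  exact: (IH _ _ (times_differentiableW tf) (dpg j)).
exact: (IH _ _ (times_differentiableW tg) (dpf j)).
Qed.

Lemma times_differentiable_sum m (I : Type) (s : seq I) (F : I -> 'rV[R]_p -> R) :
  (forall i, times_differentiable m (F i)) ->
  times_differentiable m (fun x => \sum_(i <- s) F i x).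
Proof.
move=> tF; elim: s => [|i s IH].
  under eq_fun do rewrite big_nil; exact: times_differentiable_cst.
under eq_fun do rewrite big_cons; exact: times_differentiableD.
Qed.

Lemma times_differentiable_coord m (i : 'I_p) :
  times_differentiable m (fun x : 'rV[R]_p => x ord0 i).
Proof.
case: m => [//|m]; split => [x|j]; first exact: differentiable_coord.
rewrite (_ : partial j _ = fun=> (i == j)%:R);
  first exact: times_differentiable_cst.
apply/funext => x; rewrite /partial deriveE; last exact: differentiable_coord.
pose c := (fun x : 'rV[R]_p => x ord0 i).
have cl : linear c by move=> a u v; rewrite /c !mxE.
pose C : {linear 'rV[R]_p -> R} := HB.pack c (GRing.isLinear.Build _ _ _ _ c cl).
rewrite -[LHS]/('d (C : _ -> _) x (delta_mx ord0 j)) diff_lin.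
  by rewrite /= /c mxE eqxx.
by move=> y; exact: coord_continuous.
Qed.

End times_differentiable_theory.

Section truncated_power.
Context (R : realType).

(** The exponent is at least 2, so the zero branch and the power branch glue differentiably at 0,
    and the derivative is again a truncated power. *)
Lemma is_derive_truncated_power (n : nat) (t : R) :
  is_derive t 1 (fun s : R => Num.max s 0 ^+ n.+2)
    (n.+2%:R * Num.max t 0 ^+ n.+1).
Proof.
have [t0|t0|->] := ltgtP t 0.
- rewrite (_ : _ * _ = 0); last by rewrite expr0n mulr0.
  apply: (@near_eq_is_derive _ _ _ (fun=> 0)).
    near=> s; rewrite max_r ?expr0n//.
    near: s; apply: filterS (lt_nbhsl t0) => s; exact: ltW.
- apply: (@near_eq_is_derive _ _ _ (fun s : R => s ^+ n.+2)).
    near=> s; rewrite max_l//.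
    near: s; apply: filterS (lt_nbhsr t0) => s; exact: ltW.
  apply: DeriveDef; first exact: exprn_derivable.
  by rewrite exp_derive /GRing.scale/= mulr1.
- rewrite (_ : _ * _ = 0); last by rewrite expr0n mulr0.
  (* At [t = 0] the difference quotient is squeezed between [- F h] and [F h], and [F] tends to
     0. *)
  pose F (h : R) := `|h| ^+ n.+1.
  have F0 : F h @[h --> 0^'] --> 0.
        suff F0 : F h @[h --> 0] --> 0 by move=> A /F0; exact: nbhs_dnbhs.
    have F00 : F 0 = 0 by rewrite /F normr0 expr0n.
    rewrite -[X in _ --> X]F00.
    apply: (@continuous_comp _ _ _ (fun u : R => `|u|) (fun u : R => u ^+ n.+1)).
      exact: norm_continuous.
    exact: exprn_continuous.
  suff h : (fun h : R => h^-1 *: (((fun s : R => Num.max s 0 ^+ n.+2) \o shift 0)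
      (h *: 1) - Num.max 0 0 ^+ n.+2)) @ 0^' --> (0 : R).
    split; first by apply/cvg_ex; exists 0.
    exact: cvg_lim h.
  apply: (@squeeze_cvgr _ _ _ _ (fun h => - F h) F) => //.
    near=> h; rewrite /F /= maxxx expr0n subr0 addr0 /GRing.scale /= mulr1.
    rewrite -ler_norml normrM normfV normrX.
    have h0 : h != 0 by near: h; exact: nbhs_dnbhs_neq.
    rewrite ler_pdivrMl ?normr_gt0// -exprS lerXn2r ?nnegrE//.
    by rewrite ger0_norm ?le_max ?lexx ?orbT// ge_max ler_norm normr_ge0.
  by rewrite -[X in _ --> X]oppr0; exact: cvgN.
Unshelve. all: by end_near. Qed.

End truncated_power.

Section ball_bump.
Context (R : realType) (p : nat).
Implicit Types (x : 'rV[R]_p) (j : 'I_p) (m N : nat).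

Definition bump_base x : R := 1 - \sum_j x ord0 j ^+ 2.

(** Only finitely many derivatives are wanted, so a truncated power takes the place of the usual
    smooth exponential bump. *)
Definition ball_bump N x : R := Num.max (bump_base x) 0 ^+ N.

Lemma times_differentiable_bump_base m : times_differentiable m bump_base.
Proof.
rewrite (_ : bump_base = fun x => 1 + \sum_j - 1 * (x ord0 j * x ord0 j)).
  apply: times_differentiableD; first exact: times_differentiable_cst.
  apply: times_differentiable_sum => j.
  apply: times_differentiableM; first exact: times_differentiable_cst.
  by apply: times_differentiableM; exact: times_differentiable_coord.
apply/funext => x; rewrite /bump_base -sumrN; congr (_ + _).
by apply: eq_bigr => j _; rewrite mulN1r expr2.
Qed.

Lemma is_diff_bump N x : differentiable (ball_bump N.+2) x /\
  forall j, partial j (ball_bump N.+2) x =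
            N.+2%:R * ball_bump N.+1 x * partial j bump_base x.
Proof.
have [dw _] := times_differentiable_bump_base 1.
pose h := fun s : R => Num.max s 0 ^+ N.+2.
have [dh hE] := @is_derive_truncated_power R N (bump_base x).
have dhx : differentiable h (bump_base x) by apply/derivable1_diffP.
have -> : ball_bump N.+2 = h \o bump_base by [].
have dc : differentiable (h \o bump_base) x by exact: differentiable_comp.
split=> // j; rewrite /partial deriveE// diff_comp//= [in RHS]deriveE//.
set a := 'd bump_base x _.
have -> : 'd h (bump_base x) a = a *: 'd h (bump_base x) 1.
  by rewrite -linearZ/= /GRing.scale/= mulr1.
by rewrite -deriveE// hE /GRing.scale/= mulrC.
Qed.

(** Each derivative lowers the exponent by one and brings out a polynomial factor, so [m < N]
    survives the induction. *)
Lemma times_differentiable_bump m N : (m < N)%N ->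
  times_differentiable m (ball_bump N).
Proof.
elim: m N => [//|m IH] [//|[//|N]]; rewrite ltnS => mN; split=> [x|j].
  by have [] := is_diff_bump N x.
rewrite (_ : partial j _ = fun x => N.+2%:R * ball_bump N.+1 x * partial j bump_base x).
  apply: times_differentiableM.
    by apply: times_differentiableM; [exact: times_differentiable_cst|exact: IH].
  by have [_] := times_differentiable_bump_base m.+1; exact.
by apply/funext => x; have [_] := is_diff_bump N x; exact.
Qed.

Lemma bump_ge0 N x : 0 <= ball_bump N x.
Proof. by rewrite exprn_ge0// le_max lexx orbT. Qed.

Lemma bump0 N : ball_bump N 0 = 1.
Proof.
rewrite /ball_bump /bump_base big1 ?subr0; last by move=> j _; rewrite mxE expr0n.
by rewrite max_l// expr1n.
Qed.

(** Here [|x|] is the sup norm: some coordinate has square above 1, which makes [bump_base x]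
    negative or zero. *)
Lemma bump_out N x : (0 < N)%N -> 1 < `|x| -> ball_bump N x = 0.
Proof.
case: N => // N _ x1; rewrite /ball_bump max_r ?expr0n//.
rewrite subr_le0; have [|i xi] := @mx_norm_neq0 _ _ _ x.
  by rewrite gt_eqF// (lt_trans ltr01).
move: x1; rewrite -[`|x|]/(mx_norm x) xi (ord1 i.1) => x1.
rewrite (bigD1 i.2)//= ler_wpDr ?sumr_ge0// => [j _|]; first exact: sqr_ge0.
by rewrite -real_normK ?num_real// exprn_ege1// ltW.
Qed.

End ball_bump.

(** * Lipschitz bounds for derivatives of functions supported in the unit ball *)

Section compact_support.
Context (R : realType) (p : nat).
Implicit Types (f : 'rV[R]_p -> R) (x y : 'rV[R]_p) (j : 'I_p).

Definition supported f := forall x, 1 < `|x| -> f x = 0.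

(** The condition [1 < |x|] is open, so [f] vanishes in a neighbourhood of such an [x]. *)
Lemma partial_supported j f : supported f -> supported (partial j f).
Proof.
move=> f0 x x1; rewrite /partial (@near_eq_derive _ _ _ _ (fun=> 0)).
  by rewrite derive_cst.
have : \forall y \near x, 1 < `|y|.
  exact: (cvgr_gt _ (@norm_continuous _ _ x)).
by apply: filterS => y; exact: f0.
Qed.

Lemma supported_bounded f : continuous f -> supported f ->
  exists2 B, 0 <= B & forall x, `|f x| <= B.
Proof.
move=> cf f0.
pose A := [set x : 'rV[R]_p | `|x| <= 1].
have cA : compact A.
  apply: bounded_closed_compact.
    by exists 1; split; rewrite ?num_real// => r r1 x /= /le_trans; apply;
      exact: ltW.
  apply: (@closed_comp _ _ (fun x : 'rV[R]_p => `|x|) [set r | r <= 1]).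
    by move=> x _; exact: norm_continuous.
  exact: closed_le.
have A0 : A !=set0 by exists 0; rewrite /A/= normr0.
have cnf : {within A, continuous (fun x => `|f x|)}.
  apply: continuous_subspaceT => x.
  by apply: (@continuous_comp _ _ _ f (fun u : R => `|u|));
    [exact: cf|exact: norm_continuous].
have [c _ fc] := EVT_max_rV A0 cA cnf.
exists `|f c| => // x; have [x1|x1] := leP `|x| 1; first by apply: fc; rewrite inE.
by rewrite f0// normr0.
Qed.

Lemma derive_segment f x (v : 'rV[R]_p) (t : R) : (forall y, differentiable f y) ->
  is_derive t 1 (fun s : R => f (x + s *: v)) ('D_v f (x + t *: v)).
Proof.
move=> df; split.
  apply/derivable1P; rewrite /= (_ : (fun _ => _)
    = fun h => f (h *: v + (x + t *: v))).
    by apply: (derivable1P f (x + t *: v) v).1; exact: diff_derivable.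
  by apply/funext => h; rewrite scalerDl addrCA [_%:A]mulr1.
rewrite /derive; set g := (X in lim (X @ _)); set k := (X in _ = lim (X @ _)).
suff -> : g = k by [].
by apply/funext => h; rewrite /g /k /= scalerDl addrCA [_%:A]mulr1.
Qed.

(** Two derivatives make [f] and its partials continuous, hence bounded. The minimum joins the sup
    bound with the mean value bound, and it is this form that yields every Hoelder exponent in
    [0, 1]. *)
Lemma supported_lipschitz f : times_differentiable 2 f -> supported f ->
  exists2 B, 0 <= B & forall x y, `|f x - f y| <= B * Num.min 1 `|x - y|.
Proof.
move=> [df dpf] f0.
have cont (g : 'rV[R]_p -> R) : (forall x, differentiable g x) -> continuous g.
  by move=> dg x; exact: differentiable_continuous.
have [B0 B00 fB0] := supported_bounded (cont _ df) f0.
have /choice[B fB] : forall j, exists B, 0 <= B /\ forall x, `|partial j f x| <= B.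
  move=> j; have [dj _] := dpf j.
  have [B ? ?] := supported_bounded (cont _ dj) (partial_supported j f0).
  by exists B.
have sB0 : 0 <= \sum_j B j by apply: sumr_ge0 => j _; have [] := fB j.
exists (2 * B0 + \sum_j B j); first by rewrite addr_ge0// mulr_ge0.
move=> x y; rewrite minr_pMr ?addr_ge0 ?mulr_ge0// le_min mulr1; apply/andP; split.
  rewrite (le_trans (ler_normB _ _))//.
  by have := fB0 x; have := fB0 y; lra.
pose v := x - y.
have fline : {within `[0, 1], continuous (fun s : R => f (y + s *: v))}.
  apply: continuous_subspaceT => s; apply: differentiable_continuous.
  by apply/derivable1_diffP; have [] := derive_segment y v s df.
have [c _] := MVT_segment ler01 (fun s _ => derive_segment y v s df) fline.
rewrite scale1r scale0r addr0 subr0 mulr1.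
have -> : y + v = x by rewrite addrC subrK.
move=> ->.
rewrite deriveE// [X in 'd f _ X]row_sum_delta linear_sum/=.
rewrite (le_trans (ler_norm_sum _ _ _))//.
rewrite mulrDl ler_wpDl ?mulr_ge0// mulr_suml ler_sum// => j _.
rewrite linearZ/= normrM mulrC -deriveE// ler_pM//; first by have [_] := fB j;
  exact.
by rewrite [leRHS]mx_normrE; apply: (le_bigmax _ _ (ord0, j)).
Qed.

Lemma iter_partial_lipschitz l f : times_differentiable l.+2 f -> supported f ->
  exists2 B, 0 <= B & forall s : seq 'I_p, size s = l ->
    forall x y, `|foldr (@partial R p) f s x - foldr (@partial R p) f s y|
      <= B * Num.min 1 `|x - y|.
Proof.
elim: l f => [|l IH] f tf f0.
  have [B B0 fB] := supported_lipschitz tf f0.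
  by exists B => // -[].
have [df dpf] := tf.
have /choice[B fB] : forall j, exists B, 0 <= B /\
  forall s : seq 'I_p, size s = l ->
    forall x y, `|foldr (@partial R p) (partial j f) s x -
                  foldr (@partial R p) (partial j f) s y| <= B * Num.min 1 `|x - y|.
  move=> j; have [B ? ?] := IH _ (dpf j) (partial_supported j f0).
  by exists B.
exists (\sum_j B j); first by apply: sumr_ge0 => j _; have [] := fB j.
(* [foldr] differentiates along the last entry first, so the induction peels the list from the
   right. *)
case/lastP => // s j; rewrite size_rcons => -[sl] x y; rewrite foldr_rcons.
have [_ /(_ s sl x y) /le_trans] := fB j; apply.
rewrite ler_wpM2r ?le_min ?ler01//= (bigD1 j)//= ler_wpDr// sumr_ge0// => i _.
by have [] := fB i.
Qed.

Lemma iter_partial_supported f s : supported f ->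
  supported (foldr (@partial R p) f s).
Proof. by move=> f0; elim: s => //= j s IH; exact: partial_supported. Qed.

(** Replaces the multi-index by a flat list of directions, on which inductions run. *)
Lemma mixed_partialE (k : 'I_p -> nat) : exists2 s : seq 'I_p,
  size s = (\sum_j k j)%N & forall f, mixed_partial k f = foldr (@partial R p) f s.
Proof.
exists (flatten [seq nseq (k j) j | j <- enum 'I_p]).
  rewrite size_flatten /shape -map_comp sumnE big_map big_enum/=.
  by apply: eq_bigr => j _; rewrite size_nseq.
move=> f; rewrite /mixed_partial; elim: (enum _) => //= j s ->.
by rewrite foldr_cat; elim: (k j) => //= n ->.
Qed.

End compact_support.

(** * Sums of rescaled copies of a function at separated centres *)

Section scaled_sum.
Context (R : realType) (p : nat) (n : nat) (c : 'I_n -> 'rV[R]_p)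
  (G : {set 'I_n}) (r : R).
Hypothesis r0 : 0 < r.
Implicit Types (f : 'rV[R]_p -> R) (x y : 'rV[R]_p) (j : 'I_p).

Definition scaled_sum (a : R) f : 'rV[R]_p -> R :=
  fun x => \sum_(i < n) if i \in G then a * f (r^-1 *: (x - c i)) else 0.

(** The family [scaled_sum] is stable under partial derivatives, each costing a factor [1 / r] by
    the chain rule. *)
Lemma is_diff_scaled_sum a f : (forall x, differentiable f x) ->
  (forall x, differentiable (scaled_sum a f) x) /\
  forall j, partial j (scaled_sum a f) = scaled_sum (a / r) (partial j f).
Proof.
move=> df.
pose F (i : 'I_n) (x : 'rV[R]_p) := if i \in G then a * f (r^-1 *: (x - c i))
  else 0.
have -> : scaled_sum a f = \sum_(i < n) F i.
  by apply/funext => x; rewrite fct_sumE.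
have key i x : differentiable (F i) x /\ forall j, partial j (F i) x =
    if i \in G then a / r * partial j f (r^-1 *: (x - c i)) else 0.
  have [iG|/negbTE iG] := boolP (i \in G); rewrite /F iG; last first.
    split; first exact: differentiable_cst.
    by move=> j; rewrite /partial derive_cst.
  pose h (x : 'rV[R]_p) := r^-1 *: (x - c i).
  have dh y : differentiable h y.
    by apply: differentiableZ; apply: differentiableB.
  have dfh y : differentiable (f \o h) y by exact: differentiable_comp.
  have -> : (fun x => a * f (r^-1 *: (x - c i))) = a *: (f \o h) by [].
  split=> [|j]; first exact: differentiableZ.
  rewrite /partial deriveZ; last exact: diff_derivable.
  rewrite deriveE// diff_comp//= -[in RHS]mulrA; congr (_ * _).
  rewrite deriveE//.
  have -> : 'd h x (delta_mx ord0 j) = r^-1 *: delta_mx ord0 j.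
        rewrite -deriveE// -[h]/(r^-1 *: (id - cst (c i))).
    rewrite deriveZ; last by apply: derivableB;
      [exact: derivable_id|exact: derivable_cst].
    by rewrite deriveB// derive_id derive_cst subr0.
  by rewrite linearZ.
split=> [x|j].
  by apply: differentiable_sum => i; have [] := key i x.
apply/funext => x; rewrite /partial derive_sum; last first.
  by move=> i; apply: diff_derivable; have [] := key i x.
by apply: eq_bigr => i _; have [_ /(_ j)] := key i x.
Qed.

Lemma times_differentiable_scaled_sum m a f : times_differentiable m f ->
  times_differentiable m (scaled_sum a f).
Proof.
elim: m a f => [//|m IH] a f [df dpf].
have [dS pS] := is_diff_scaled_sum a df; split=> // j.
by rewrite pS; exact: (IH _ _ (dpf j)).
Qed.

Lemma times_differentiable_foldr (s : seq 'I_p) m f :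
  times_differentiable (size s + m) f ->
  times_differentiable m (foldr (@partial R p) f s).
Proof.
elim: s m => [//|j s IH] m; rewrite [size _]/= addSnnS => /IH[_]; exact.
Qed.

Lemma foldr_partial_scaled_sum a f (s : seq 'I_p) :
  times_differentiable (size s) f ->
  foldr (@partial R p) (scaled_sum a f) s =
  scaled_sum (a / r ^+ size s) (foldr (@partial R p) f s).
Proof.
elim: s => [|j s IH] /= tf; first by rewrite expr0 divr1.
rewrite IH; last exact: times_differentiableW.
have [|df _] := @times_differentiable_foldr s 1 f; first by rewrite addn1.
have [_ ->] := is_diff_scaled_sum (a / r ^+ size s) df.
by rewrite exprSr invfM mulrA.
Qed.

Hypothesis cG : {in G &, forall i k, i != k -> 2 * r < `|c i - c k|}.

(** The sup-norm balls of radius [r] around the centres are disjoint, so at most one term is alive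
    at [x] and at most one at [y]. This gives the factor 2, whatever the number of centres. *)
Lemma scaled_sum_lipschitz a f B : supported f -> 0 <= a ->
  (forall x y, `|f x - f y| <= B * Num.min 1 `|x - y|) ->
  forall x y, `|scaled_sum a f x - scaled_sum a f y|
    <= 2 * (a * B * Num.min 1 (r^-1 * `|x - y|)).
Proof.
move=> f0 a0 fB x y.
pose act z := [set i in G | `|r^-1 *: (z - c i)| <= 1].
have act1 z : (#|act z| <= 1)%N.
  apply/card_le1_eqP => i k; rewrite !inE !normrZ ger0_norm ?invr_ge0 ?(ltW r0)//.
  move=> /andP[iG +] /andP[kG]; rewrite !ler_pdivrMl// mulr1 => zi zk.
  apply: contraTeq isT; rewrite eq_sym => ik; have := cG iG kG ik.
  rewrite ltNge => /negP; case; rewrite (le_trans (ler_distD z _ _))//.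
  by rewrite distrC mulr2n mulrDl mul1r lerD.
rewrite /scaled_sum -sumrB (le_trans (ler_norm_sum _ _ _))//.
set b := a * B * _.
(* No sign is assumed for [B]; it comes from the Lipschitz bound itself at a rescaled pair. *)
have b0 : 0 <= b.
  rewrite /b -mulrA mulr_ge0//.
  have := fB (r^-1 *: x) (r^-1 *: y);
    rewrite -scalerBr normrZ gtr0_norm ?invr_gt0//.
  by apply: le_trans; exact: normr_ge0.
have -> : 2 * b = b + b by rewrite mulr_natl mulr2n.
have sum_act z : \sum_(i < n) (if i \in act z then b else 0) <= b.
  rewrite -big_mkcond/= sumr_const.
  by have := act1 z; case: #|_| => [|[|]].
(* Termwise, an increment is at most [b] if its index is active at [x] or at [y], and 0 otherwise
   (the fourth case). *)
rewrite (le_trans _ (lerD (sum_act x) (sum_act y)))// -big_split/=.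
apply: ler_sum => i _; rewrite !inE; case: ifPn => iG /=;
  last by rewrite subrr normr0 addr0.
case: ifPn => [_|]; [|rewrite -ltNge => xi]; (case: ifPn => [_|];
  [|rewrite -ltNge => yi]).
4: by rewrite !f0// !mulr0 subrr normr0 addr0.
all: rewrite -mulrBr normrM (ger0_norm a0).
all: have {}fB : a * `|f (r^-1 *: (x - c i)) - f (r^-1 *: (y - c i))| <= b
  by rewrite /b -mulrA ler_wpM2l// (le_trans (fB _ _))// -scalerBr normrZ
     gtr0_norm ?invr_gt0// opprB addrA subrK.
all: rewrite (le_trans fB)// ?add0r ?addr0 ?ler_wpDr//.
Qed.

End scaled_sum.

(** * Membership of the rescaled sums in the Hoelder class *)

Section hoelder_scaled_sum.
Context (R : realType) (p : nat).
Implicit Types (x y : 'rV[R]_p).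

Lemma norm_le_enorm x : `|x| <= enorm x.
Proof.
rewrite [leLHS]mx_normrE; apply: bigmax_le => [|[i j] _]; first exact: sqrtr_ge0.
rewrite (ord1 i)/= -sqrtr_sqr ler_sqrt ?sumr_ge0// => [|k _]; last exact: sqr_ge0.
by rewrite (bigD1 j)//= ler_wpDr// sumr_ge0// => k _; exact: sqr_ge0.
Qed.

(** If [s >= 1] the power is at least 1 because [b >= 0]; if [s < 1] it is at least [s] because
    [b <= 1]. *)
Lemma min1_le_powR (s b : R) : 0 <= s -> 0 <= b <= 1 -> Num.min 1 s <= s `^ b.
Proof.
move=> s0 /andP[b0 b1]; have [s1|s1] := leP 1 s.
  by rewrite -[leLHS](powRr0 s) ler_powR.
have [->|sn0] := eqVneq s 0; first exact: powR_ge0.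
by rewrite -[leLHS]powRr1// ger_powR// lt0r sn0 s0 (ltW s1).
Qed.

Lemma hoelder_class0 (gamma C : R) : 0 < C -> @hoelder_class R p gamma C (fun=> 0).
Proof.
move=> C0; split=> [|k _ x x']; first exact: times_differentiable_cst.
have [s _ ->] := mixed_partialE R k.
suff -> : foldr (@partial R p) (fun=> 0) s = fun=> 0.
  by rewrite subrr normr0 mulr_ge0// ?powR_ge0// ltW.
by elim: s => //= j s ->; apply/funext => y; rewrite /partial derive_cst.
Qed.

(* The constant [a] does not depend on the scale [r] nor on the separated
   centers: rescaling turns an increment of an [l]-th derivative into
   [r ^ (gamma - l) * min 1 (|x - y| / r) <= |x - y| ^ (gamma - l)]. *)
Lemma hoelder_scaled_sum (gamma C : R) : 0 < gamma -> 0 < C ->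
  exists2 a, 0 < a & exists2 N, (0 < N)%N &
  forall (n : nat) (c : 'I_n -> 'rV[R]_p) (G : {set 'I_n}) (r : R), 0 < r ->
    {in G &, forall i k, i != k -> 2 * r < `|c i - c k|} ->
    hoelder_class gamma C (scaled_sum c G r (- (a * r `^ gamma))
      (@ball_bump R p N)).
Proof.
move=> g0 C0; set l := lt_floor gamma; have [lg lg'] := lt_floorP g0.
(* Two derivatives beyond order [l] are what the Lipschitz bound on the [l]-th derivatives asks
   for. *)
pose N := l.+3; have tb : times_differentiable l.+2 (@ball_bump R p N).
  exact: times_differentiable_bump.
have sb : supported (@ball_bump R p N) by move=> x; exact: bump_out.
have [B B0 fB] := iter_partial_lipschitz tb sb.
(* Chosen so that [2 * a * B <= C]; the [+ 1] guards against [B = 0]. *)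
pose a := C / (2 * (B + 1)).
have a0 : 0 < a by rewrite divr_gt0// mulr_gt0// ltr_wpDl.
exists a => //; exists N => // n c G r r0 cG; split.
  apply: times_differentiable_scaled_sum => //; apply: times_differentiable_bump.
  by rewrite -/l ltnS -[l.+2]addn2 leq_addr.
move=> k kl x y; have [s sl ->] := mixed_partialE R k.
have {}sl : size s = l by rewrite sl.
have tl : times_differentiable (size s) (@ball_bump R p N).
  by rewrite sl; do 2 apply: times_differentiableW.
rewrite foldr_partial_scaled_sum// sl.
have := @scaled_sum_lipschitz R p n c G r r0 cG (a * r `^ gamma / r ^+ l) _ B
  (iter_partial_supported s sb).
(* The Lipschitz bound is stated for a nonnegative amplitude, while the bumps point downwards. *)
have -> : scaled_sum c G r (a * r `^ gamma / r ^+ l) (foldr (@partial R p)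
  (ball_bump N) s)
  = fun z => - scaled_sum c G r (- (a * r `^ gamma) / r ^+ l)
    (foldr (@partial R p) (ball_bump N) s) z.
  apply/funext => z; rewrite /scaled_sum -sumrN; apply: eq_bigr => i _.
  by case: ifP; rewrite ?oppr0// !mulNr opprK.
move=> /(_ _ (fB s sl) x y) /=.
rewrite -opprD normrN => /(_ _)/le_trans; apply.
  by rewrite divr_ge0 ?exprn_ge0 ?(ltW r0)// mulr_ge0 ?powR_ge0// ltW.
set beta := gamma - l%:R.
(* If [beta] exceeded 1, then [l + 1 < gamma] would contradict the maximality of [l]. *)
have beta01 : 0 <= beta <= 1.
  rewrite subr_ge0 (ltW lg)/= lerBlDr addrC natr1 leNgt; apply/negP => /lg'.
  by rewrite ltnn.
have rb : r `^ gamma / r ^+ l = r `^ beta.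
  by rewrite /beta -powR_mulrn ?(ltW r0)// powRB// (gt_eqF r0) implybT.
have e0 : 0 <= enorm (x - y) by exact: sqrtr_ge0.
rewrite -[a * _ / _]mulrA rb.
have h1 : r `^ beta * Num.min 1 (r^-1 * `|x - y|) <= enorm (x - y) `^ beta.
  rewrite (@le_trans _ _ (r `^ beta * (r^-1 * `|x - y|) `^ beta))//.
    by rewrite ler_wpM2l ?powR_ge0// min1_le_powR// mulr_ge0// invr_ge0 ltW.
  rewrite -powRM ?mulr_ge0 ?invr_ge0 ?(ltW r0)// mulrA divff ?gt_eqF// mul1r.
  rewrite ge0_ler_powR ?nnegrE//; first by have /andP[] := beta01.
  exact: norm_le_enorm.
rewrite [leLHS](_ : _ = (2 * a * B)
  * (r `^ beta * Num.min 1 (r^-1 * `|x - y|))); last by ring.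
have aB : 0 <= 2 * a * B by rewrite mulr_ge0// mulr_ge0// ltW.
rewrite (le_trans (ler_wpM2l aB h1))// ler_wpM2r ?powR_ge0//.
rewrite /a [leLHS](_ : _ = C * (B / (B + 1))); last by field; rewrite gt_eqF//
  ltr_wpDl.
by rewrite ler_piMr ?(ltW C0)// ler_pdivrMr ?ltr_wpDl// mul1r lerDl.
Qed.

End hoelder_scaled_sum.

(** * Isolated sample points *)

Section finite_measurability.
Context d (T : measurableType d) (I : finType).

Lemma measurable_fin_forall (A : I -> set T) :
  (forall i, measurable (A i)) -> measurable [set w | forall i, A i w].
Proof.
move=> mA; rewrite (_ : [set _ | _] = \bigcap_(i in [set: I]) A i).
  by apply: fin_bigcap_measurable.
by apply/seteqP; split=> w /= h i *; exact: h.
Qed.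

Lemma measurable_fin_exists (A : I -> set T) :
  (forall i, measurable (A i)) -> measurable [set w | exists i, A i w].
Proof.
move=> mA; rewrite (_ : [set _ | _] = \bigcup_(i in [set: I]) A i).
  by apply: fin_bigcup_measurable.
by apply/seteqP; split=> w /= [i]; [exists i|exists i].
Qed.

Lemma measurable_implies (b : bool) (A : set T) :
  measurable A -> measurable [set w | b -> A w].
Proof.
case: b => mA; first by rewrite (_ : [set _ | _] = A)//; apply/seteqP;
  split=> w //=; exact.
by rewrite (_ : [set _ | _] = setT)//; apply/seteqP; split.
Qed.

Lemma measurable_and (b : bool) (A : set T) :
  measurable A -> measurable [set w | b /\ A w].
Proof.
case: b => mA; first by rewrite (_ : [set _ | _] = A)//; apply/seteqP;
  split=> w //= [].
by rewrite (_ : [set _ | _] = set0)//; apply/seteqP; split=> w //= [].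
Qed.

Lemma fin_union_bound (R : realType) (mu : {measure set T -> \bar R})
    (J : pred I) (E : set T) (A : I -> set T) :
  measurable E -> (forall i, measurable (A i)) ->
  (forall w, E w -> exists2 i, J i & A i w) ->
  (mu E <= \sum_(i | J i) mu (A i))%E.
Proof.
move=> mE mA EA.
have mU s : measurable (\big[setU/set0]_(i <- s | J i) A i).
  by apply: bigsetU_measurable.
apply: (@le_trans _ _ (mu (\big[setU/set0]_(i | J i) A i))).
  apply: le_measure; rewrite ?inE// => w /EA[i Ji Ai].
  by rewrite (bigD1 i)//=; left.
elim: (index_enum I) => [|i s IH]; first by rewrite !big_nil measure0.
rewrite !big_cons; case: ifP => // _.
by apply: (le_trans (measureU2 _ _ _)) => //; rewrite leeD2l.
Qed.

End finite_measurability.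

(** * Independence of one variable from a finite subsample *)

Section tuple_boxes.
Context d (E : measurableType d) (n : nat).

Definition boxes : set (set (n.-tuple E)) :=
  [set F | exists2 B : 'I_n -> set E, (forall i, measurable (B i)) &
    F = [set x | forall i, B i (tnth x i)]].

Lemma measurable_box (B : 'I_n -> set E) : (forall i, measurable (B i)) ->
  measurable [set x : n.-tuple E | forall i, B i (tnth x i)].
Proof.
move=> mB; apply: measurable_fin_forall => i.
by rewrite -[X in measurable X]setTI; exact: measurable_tnth.
Qed.

(** The preimage of a measurable set under a coordinate is a box with one nontrivial side. Boxes are
    closed under intersection, so Dynkin's theorem applies to them. *)
Lemma measurable_tuple_boxes : @measurable _ (n.-tuple E) = <<s boxes >>.
Proof.
apply/seteqP; split.
  apply: smallest_sub; first exact: smallest_sigma_algebra.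
  move=> F; rewrite -bigcup_seq/= => -[i _ [B mB <-]].
  apply: sub_sigma_algebra; exists (fun j => if j == i then B else setT).
    by move=> j; case: ifP.
  rewrite setTI; apply/seteqP; split=> x /=; last by move/(_ i); rewrite eqxx.
  by move=> Bx j; case: eqP => // ->.
apply: smallest_sub; first exact: sigma_algebra_measurable.
by move=> _ [B mB ->]; exact: measurable_box.
Qed.

Lemma setI_closed_boxes : setI_closed boxes.
Proof.
move=> _ _ [A mA ->] [B mB ->]; exists (fun i => A i `&` B i).
  by move=> i; exact: measurableI.
apply/seteqP; split=> [x [hA hB] i|x h]; first by split; [exact: hA|exact: hB].
by split=> i; have [] := h i.
Qed.

End tuple_boxes.

Section independence_theory.
Context d (T : measurableType d) (R : realType) (P : probability T R).
Context d' (E : measurableType d').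
Variable Z : nat -> {mfun T >-> E}.
Hypothesis indZ : mutually_independent P (fun i => Z i : T -> E).
Local Open Scope ereal_scope.

(** A free choice of indices makes it possible to leave out the variable that is to be independent
    of the rest. *)
Definition subsample n (idx : 'I_n -> nat) (w : T) : n.-tuple E :=
  [tuple Z (idx i) w | i < n].

Lemma measurable_subsample n (idx : 'I_n -> nat) :
  measurable_fun setT (subsample idx).
Proof.
apply/measurable_fun_tnthP => i.
rewrite (_ : _ \o _ = Z (idx i))//.
by apply/funext => w /=; rewrite tnth_mktuple.
Qed.

Let mpre (f : T -> E) (A : set E) : measurable_fun setT f -> measurable A ->
  measurable (f @^-1` A).
Proof. by move=> mf mA; rewrite -[X in measurable X]setTI; exact: mf. Qed.

Let mpres n (idx : 'I_n -> nat) (F : set (n.-tuple E)) : measurable F ->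
  measurable (subsample idx @^-1` F).
Proof.
by move=> mF; rewrite -[X in measurable X]setTI; exact: measurable_subsample.
Qed.

(** On boxes this is mutual independence over the indices [m :: s]; Dynkin induction extends it to
    all measurable [F]. *)
Lemma subsample_indep n (idx : 'I_n -> nat) (m : nat) (A : set E)
    (F : set (n.-tuple E)) :
  injective idx -> (forall i, idx i != m) -> measurable A -> measurable F ->
  P (Z m @^-1` A `&` subsample idx @^-1` F) =
  P (Z m @^-1` A) * P (subsample idx @^-1` F).
Proof.
move=> injidx midx mA mF.
have mZA : measurable (Z m @^-1` A) by exact: mpre.
have : <<s @boxes _ E n >> F by rewrite -measurable_tuple_boxes.
move: F {mF}; apply: dynkin_induction.
- exact: measurable_tuple_boxes.
- exact: setI_closed_boxes.
- by rewrite preimage_setT setIT probability_setT mule1.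
- move=> _ [B mB ->].
  pose s := map idx (enum 'I_n).
  have us : uniq s by rewrite map_inj_uniq// enum_uniq.
  have ms : m \notin s.
    by apply/mapP => -[i _ /esym/eqP]; apply/negP.
  (* One family of events indexed by all naturals, with [setT] at the indices outside [m :: s]. *)
  pose A' (k : nat) := if k == m then A else
    if [pick i | idx i == k] is Some i then B i else setT.
  have mA' k : measurable (A' k).
    by rewrite /A'; case: ifP => // _; case: pickP.
  have A'm : A' m = A by rewrite /A' eqxx.
  have A'i i : A' (idx i) = B i.
    rewrite /A' (negbTE (midx i)); case: pickP => [j /eqP/injidx ->//|].
    by move/(_ i); rewrite eqxx.
  have sE : subsample idx @^-1` [set x | forall i, B i (tnth x i)] =
      \bigcap_(j in [set` s]) (Z j @^-1` A' j).
    apply/seteqP; split=> w /= h.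
      by move=> _ /mapP[i _ ->]; rewrite /preimage/= A'i; have := h i;
        rewrite tnth_mktuple.
    move=> i; rewrite tnth_mktuple -A'i; apply: (h (idx i)) => /=.
    by apply: map_f; rewrite mem_enum.
  rewrite sE (indZ us mA').
  have ums : uniq (m :: s) by rewrite /= ms.
  have := indZ ums mA'; rewrite big_cons A'm => <-; congr (P _).
  apply/seteqP; split=> [w [hm hs] j|w h].
    by rewrite /= inE => /orP[/eqP ->|js]; [rewrite A'm|exact: hs].
  split=> [|j js]; first by have := h m; rewrite /= mem_head A'm; exact.
  by apply: h; rewrite /= inE; apply/orP; right.
- move=> S mS PS.
  have cE : subsample idx @^-1` (~` S) = ~` (subsample idx @^-1` S) by [].
  rewrite cE -setDE (measureD mZA (mpres idx mS));
    last by rewrite ltey_eq fin_num_measure.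
  rewrite [X in _ - X](_ : _ = P (Z m @^-1` A) * P (subsample idx @^-1` S))//.
  rewrite probability_setC; last exact: mpres.
  by rewrite muleBr ?mule1 ?fin_num_measure.
- move=> G mG tG PG.
  have tpre : trivIset setT (fun k => subsample idx @^-1` G k).
    apply/trivIsetP => i j _ _ ij; rewrite -preimage_setI.
    by move/trivIsetP : tG => /(_ _ _ Logic.I Logic.I ij) ->; rewrite preimage_set0.
  rewrite preimage_bigcup setI_bigcupr measure_semi_bigcup//.
  + rewrite (@measure_semi_bigcup _ _ _ P (fun k => subsample idx @^-1` G k))//.
    * rewrite -(@fineK _ (P (Z m @^-1` A))) ?fin_num_measure//.
      rewrite -nneseriesZl//; apply: eq_eseriesr => k _.
      by rewrite fineK ?fin_num_measure//; exact: PG.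
    * by move=> k; exact: mpres.
    * by apply: bigcup_measurable => k _; exact: mpres.
  + by move=> k; apply: measurableI => //; exact: mpres.
  + exact: trivIset_setIl.
  + by apply: bigcup_measurable => k _; apply: measurableI => //; exact: mpres.
Qed.

(** By independence the joint law is a product measure, so the uniform bound on the sections of [Q]
    can be integrated over [F]. *)
Lemma subsample_joint_bound n (idx : 'I_n -> nat) (m : nat)
    (Q : set (n.-tuple E * E)) (F : set (n.-tuple E)) (kappa : R) :
  0 <= kappa%:E -> injective idx -> (forall i, idx i != m) ->
  measurable Q -> measurable F -> (forall v, P (Z m @^-1` xsection Q v)
    <= kappa%:E) ->
  P [set w | F (subsample idx w) /\ Q (subsample idx w, Z m w)]
    <= kappa%:E * P (subsample idx @^-1` F).
Proof.
move=> kappa0 injidx midx mQ mF Qk.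
pose V : {mfun T >-> n.-tuple E} :=
  HB.pack (subsample idx)
    (isMeasurableFun.Build _ _ _ _ _ (measurable_subsample idx)).
have mVZ : measurable_fun setT (fun w => (V w, Z m w)).
  apply: measurable_fun_pair => /=; first exact: measurable_subsample.
  exact: (measurable_funPT (Z m)).
pose W : {mfun T >-> (n.-tuple E * E)%type} :=
  HB.pack (fun w => (V w, Z m w)) (isMeasurableFun.Build _ _ _ _ _ mVZ).
pose muV := distribution P V; pose muZ := distribution P (Z m).
pose Q' := Q `&` (F `*` setT).
have mQ' : measurable Q' by apply: measurableI => //; exact: measurableX.
rewrite (_ : [set w | _] = W @^-1` Q'); last first.
  by apply/seteqP; split=> w /=; [case=> ? ?; split|case=> ? [? _]].
(* Both measures agree on rectangles, which determines the product measure. *)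
have pE : (muV \x muZ) Q' = distribution P W Q'.
  apply: product_measure_unique => // A B mA mB;
    rewrite /distribution /pushforward muleC.
  by rewrite -subsample_indep// setIC.
rewrite -[P (W @^-1` _)]/(distribution P W Q') -pE /product_measure1.
apply: (@le_trans _ _ (\int[muV]_v (kappa%:E * (\1_F v)%:E))).
  apply: ge0_le_integral => //.
    - by apply: measurable_fun_xsection.
  - by apply: measurable_funeM; apply/measurable_EFinP; exact: measurable_indic.
  - move=> v _ /=; rewrite indicE; have [/set_mem vF|/negP vF] := boolP (v \in F).
      rewrite mule1; apply: le_trans (Qk v); rewrite /distribution /pushforward.
      apply: le_measure; rewrite ?inE.
            + exact: measurable_xsection.
      + exact: measurable_xsection.
      + by move=> w; rewrite /xsection/= !inE => -[].
    rewrite mule0 (_ : xsection Q' v = set0) /=; first by rewrite /muZ measure0.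
    apply/seteqP; split=> x //=; rewrite /xsection/= inE => -[_ [/= Fv _]].
    by apply: vF; rewrite inE.
rewrite ge0_integralZl//.
- by rewrite integral_indic// setIT.
- by apply/measurable_EFinP; exact: measurable_indic.

Qed.

End independence_theory.


Section random_sets.
Context d (T : measurableType d) (R : realType).

(** The event is a finite union, over the values [S] satisfying [Q], of the events [B w = S]. *)
Lemma measurable_random_set (I : finType) (B : T -> {set I}) (Q : pred {set I}) :
  (forall i, measurable [set w | i \in B w]) -> measurable [set w | Q (B w)].
Proof.
move=> mB; rewrite (_ : [set w | _] = [set w | exists S : {set I}, Q S /\
    (forall i, (i \in B w) = (i \in S))]); last first.
  apply/seteqP; split=> w /=; first by move=> QB; exists (B w).
  by move=> [S [QS /setP ->]].
apply: measurable_fin_exists => S; apply: measurable_and.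
apply: measurable_fin_forall => i; case: (i \in S); first exact: mB.
rewrite (_ : (fun w => _) = ~` [set w | i \in B w]); first exact: measurableC.
by apply/seteqP; split=> w /=; [move=> ->|move/negP/negbTE].
Qed.

Definition box_close (p : nat) (rho : R) (x y : p.-tuple R) : bool :=
  [forall k, `|tnth x k - tnth y k| <= rho].

Lemma measurable_close (p : nat) (rho : R) (f g : T -> p.-tuple R) :
  measurable_fun setT f -> measurable_fun setT g ->
  measurable [set w | box_close rho (f w) (g w)].
Proof.
move=> mf mg; rewrite (_ : [set w | _] =
  [set w | forall k, `|tnth (f w) k - tnth (g w) k| <= rho]); last first.
  by apply/seteqP; split=> w /forallP.
apply: measurable_fin_forall => k.
have mt (h : T -> p.-tuple R) : measurable_fun setT h ->
  measurable_fun setT (fun w => tnth (h w) k).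
  by move=> mh; apply: (measurableT_comp (measurable_tnth k) mh).
have mn : measurable_fun setT (fun w => `|tnth (f w) k - tnth (g w) k|).
  by apply: measurableT_comp => //; apply: measurable_funB; exact: mt.
have := mn measurableT `]-oo, rho]%classic (measurable_itv _).
by rewrite setTI; congr measurable.
Qed.

End random_sets.

(** * Exponential bounds for crowded and untreated sample points *)

Section sample_bounds.
Context (R : realType) (p : nat) d (T : measurableType d) (P : probability T R).
Variables (X : nat -> {mfun T >-> p.-tuple R}) (D : nat -> {mfun T >-> bool}).
Hypothesis indXD : mutually_independent P (fun i w => (X i w, D i w)).

Let indX : mutually_independent P (fun i => X i : T -> p.-tuple R).
Proof.
move=> J A uJ mA.
by have := @indXD J (fun j => A j `*` setT) uJ (fun j => measurableX (mA j)
  measurableT);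
  congr (P _ = _); [|]; [apply: eq_bigcapr => j _|apply: eq_bigr => j _;
    congr (P _)];
  apply/seteqP; split=> w /=; [case|split|case|split].
Qed.

Let indD : mutually_independent P (fun i => D i : T -> bool).
Proof.
move=> J A uJ mA.
by have := @indXD J (fun j => setT `*` A j)
  uJ (fun j => measurableX measurableT (mA j));
  congr (P _ = _); [|]; [apply: eq_bigcapr => j _|apply: eq_bigr => j _;
    congr (P _)];
  apply/seteqP; split=> w /=; [case|split|case|split].
Qed.

Section close_bounds.
Variables (rho kappa : R) (n : nat).
Hypothesis Pclose : forall m x, (P (X m @^-1` [set y | box_close rho y x])
  <= kappa%:E)%E.

(** [J i] holds the admissible partners of [i]. With [S] and [J] fixed, the treatments no longer
    enter the event. *)
Definition close_family (S : {set 'I_n}) (J : 'I_n -> {set 'I_n}) : set T :=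
  [set w | forall i, i \in S -> exists j, j \in J i /\ box_close rho (X i w)
    (X j w)].

Lemma measurable_close_family S J : measurable (close_family S J).
Proof.
apply: measurable_fin_forall => i; apply: measurable_implies.
apply: measurable_fin_exists => j; apply: measurable_and.
exact: measurable_close.
Qed.

Let kappa0 : 0 <= kappa.
Proof.
by rewrite -lee_fin; apply: le_trans (Pclose 0 [tuple 0 | i < p]);
  exact: measure_ge0.
Qed.

(* The largest element [m] of [S] is the partner of no other element of [S],
   so [X m] is independent of the remaining constraints. *)
Lemma close_family_bound (S : {set 'I_n}) (J : 'I_n -> {set 'I_n}) :
  (forall i j, i \in S -> j \in J i -> j != i /\ (j \notin S \/ (j < i)%N)) ->
  (P (close_family S J) <= ((n%:R * kappa) ^+ #|S|)%:E)%E.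
Proof.
move: {2}#|S| (erefl #|S|) => k; elim: k S => [|k IH] S cS JS.
  by rewrite cS expr0; apply: probability_le1; exact: measurable_close_family.
have [i0 i0S] : exists i, i \in S by apply/set0Pn; rewrite -card_gt0 cS.
have [m mS mmax] : exists2 m, m \in S & forall i, i \in S -> (i <= m)%N.
  by case: (@arg_maxnP _ i0 (mem S) val i0S) => m mS mmax; exists m.
pose S' := S :\ m.
have cS' : #|S'| = k by move: cS; rewrite (cardsD1 m) mS add1n => -[].
have JS' i j : i \in S' -> j \in J i ->
  [/\ i != m, j != m, j != i & j \notin S' \/ (j < i)%N].
  rewrite !inE => /andP[im iS] jJ; have [ji jS] := JS _ _ iS jJ.
  split=> //; last by case: jS => jS; [left; rewrite negb_and jS orbT|right].
  apply/eqP => jm; subst j; case: jS; first by rewrite mS.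
  by rewrite ltnNge mmax.
(* Sending [m] to the fresh index [n] keeps tuples of length [n] and avoids [X m]; coordinate [m] is
   not read by [F] or by the partners of [m]. *)
pose idx (i : 'I_n) : nat := if i == m then n else i.
have injidx : injective idx.
  move=> i j; rewrite /idx; case: eqP => [->|_]; case: eqP => [-> //|_].
  - by move=> nj; have := ltn_ord j; rewrite -nj ltnn.
  - by move=> ni; have := ltn_ord i; rewrite ni ltnn.
  - exact: val_inj.
have idxm i : idx i != m.
  rewrite /idx; case: (eqVneq i m) => [_|//]; by rewrite gtn_eqF// ltn_ord.
have idxE i : i != m -> idx i = i by rewrite /idx => /negbTE ->.
pose V := subsample X idx.
have VE w i : i != m -> tnth (V w) i = X i w.
  by move=> im; rewrite tnth_mktuple idxE.
pose F := [set v : n.-tuple (p.-tuple R) | forall i, i \in S' ->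
  exists j, j \in J i /\ box_close rho (tnth v i) (tnth v j)].
have mF : measurable F.
  apply: measurable_fin_forall => i; apply: measurable_implies.
  apply: measurable_fin_exists => j; apply: measurable_and.
  by apply: measurable_close; exact: measurable_tnth.
have VF : V @^-1` F = close_family S' J.
  apply/seteqP; split=> w h i iS'; have [j [jJ cij]] := h i iS'; exists j;
    have [im jm _ _] := JS' _ _ iS' jJ; split=> //; by move: cij; rewrite !VE.
pose Q j := [set vx : n.-tuple (p.-tuple R)
  * p.-tuple R | box_close rho vx.2 (tnth vx.1 j)].
have mQ j : measurable (Q j).
  apply: measurable_close; first exact: measurable_snd.
  by apply: (measurableT_comp (measurable_tnth j)); exact: measurable_fst.
pose A j := [set w | F (V w) /\ Q j (V w, X m w)].
have mV : measurable_fun setT V by exact: measurable_subsample.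
have mA j : measurable (A j).
  rewrite (_ : A j = V @^-1` F `&` (fun w => (V w, X m w)) @^-1` Q j)//.
  apply: measurableI; rewrite -[X in measurable X]setTI.
    exact: mV.
  by apply: measurable_fun_pair => //; exact: measurable_funPT.
(* Union bound over the partner of [m]: at most [n] choices, each contributing [kappa] times the
   bound for [S']. *)
apply: (le_trans (@fin_union_bound _ _ _ R P (mem (J m)) _ A
    (measurable_close_family S J) mA _)).
  move=> w h; have [j [jJ cj]] := h m mS; exists j => //; split.
    rewrite -[F _]/((V @^-1` F) w) VF => i; rewrite !inE => /andP[_]; exact: h.
  by rewrite /Q/= VE//; have [] := JS _ _ mS jJ.
apply: (@le_trans _ _ (\sum_(j in J m) (kappa * (n%:R * kappa) ^+ k)%:E)%E).
  apply: lee_sum => j _.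
  apply: (le_trans (@subsample_joint_bound _ _ _ P _ _ X indX n idx m (Q j)
    F kappa kappa0 injidx idxm (mQ j) mF _)).
    move=> v; rewrite (_ : xsection (Q j)
      v = [set y | box_close rho y (tnth v j)]) ?Pclose//.
    by apply/seteqP; split=> x; rewrite /xsection/= inE.
  rewrite EFinM lee_wpmul2l ?lee_fin// -[X in P X]/(V @^-1` F) VF -cS'.
  by apply: IH => // i j' iS' /(JS' _ _ iS')[].
rewrite sumEFin lee_fin cS exprS sumr_const -[leLHS]mulr_natl mulrA.
rewrite ler_wpM2r ?exprn_ge0 ?mulr_ge0// ler_wpM2r// ler_nat.
by rewrite -[X in (_ <= X)%N]card_ord max_card.
Qed.

(** Among untreated neighbours only earlier ones count. This still separates the remaining points
    pairwise, and it provides the order needed for peeling off the largest index. *)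
Definition crowded (w : T) : {set 'I_n} :=
  [set i : 'I_n | ~~ D i w && [exists j : 'I_n, (D j w || (j < i)%N)
    && box_close rho (X i w) (X j w)]].

Lemma measurable_treatment i (b : bool) : measurable [set w | D i w = b].
Proof. by rewrite -[X in measurable X]setTI;
  exact: (@measurable_funPT _ _ _ _ (D i) measurableT [set b]). Qed.

Lemma measurable_crowded i : measurable [set w | i \in crowded w].
Proof.
rewrite (_ : [set w | _] = [set w | D i w = false] `&`
  [set w | exists j : 'I_n, ((D j w = true) \/ (j < i)%N)
    /\ box_close rho (X i w) (X j w)]); last first.
  apply/seteqP; split=> w /=; rewrite inE.
    move=> /andP[/negbTE Di /existsP[j /andP[/orP Dj cij]]]; split => //.
    by exists j.
  move=> [-> [j [Dj cij]]]; apply/existsP; exists j; rewrite cij andbT.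
  by apply/orP.
apply: measurableI; first exact: measurable_treatment.
apply: measurable_fin_exists => j; apply: measurableI; last exact: measurable_close.
apply: measurableU; first exact: measurable_treatment.
rewrite [X in measurable X](_ : _ = if (j < i)%N then setT else set0).
  by case: ifP.
by case: (j < i)%N; apply/seteqP; split.
Qed.

(** A set [S] with [n <= N * #|S|] is the crowded set with probability at most
    [(1 / 4) ^+ (N * #|S|) <= (1 / 4) ^+ n]; summing over [2 ^ n] sets leaves [(1 / 2) ^+ n]. *)
Lemma crowded_bound (N : nat) : (0 < N)%N -> n%:R * kappa <= (1 / 4) ^+ N ->
  (P [set w | (n <= N * #|crowded w|)%N] <= ((1 / 2) ^+ n)%:E)%E.
Proof.
move=> N0 nk.
(* A treated partner lies outside [S], since crowded points are untreated; any other partner is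
   earlier. *)
pose J (S : {set 'I_n}) (i : 'I_n) := [set j : 'I_n | (j != i) && ((j \notin S)
  || (j < i)%N)]%SET.
have mE : measurable [set w | (n <= N * #|crowded w|)%N].
  by apply: (measurable_random_set (B := crowded)
    (fun S => (n <= N * #|S|)%N)); exact: measurable_crowded.
apply: (le_trans (@fin_union_bound _ _ _ R P (fun S : {set 'I_n} => (n <= N * #|S|)%N) _
  (fun S => close_family S (J S)) mE (fun S => measurable_close_family S (J S)) _)).
  move=> w nb; exists (crowded w) => // i;
    rewrite inE => /andP[Di /existsP[j /andP[Dj cij]]].
  exists j; split=> //; rewrite !inE negb_and negbK.
  have [Djw|Djw] := boolP (D j w).
    by rewrite /= andbT; apply/eqP => ji; rewrite -ji Djw in Di.
  move: Dj; rewrite (negbTE Djw) /= => ji; rewrite ji orbT andbT.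
  by apply/eqP => jiE; rewrite jiE ltnn in ji.
apply: (@le_trans _ _ (\sum_(S : {set 'I_n}) ((1 / 4) ^+ n)%:E)%E).
  rewrite big_mkcond/=; apply: lee_sum => S _; case: ifPn => nS;
    last by rewrite lee_fin exprn_ge0.
  apply: (le_trans (close_family_bound _)).
    by move=> i j iS; rewrite inE => /andP[ji /orP].
  rewrite lee_fin (@le_trans _ _ (((1 / 4) ^+ N) ^+ #|S|))//.
    by rewrite lerXn2r ?nnegrE ?mulr_ge0 ?exprn_ge0.
  by rewrite -exprM ler_wiXn2l//; lra.
have cS : #|{set 'I_n}| = (2 ^ n)%N by rewrite -cardsT -powersetT card_powerset cardsT card_ord.
rewrite sumEFin lee_fin sumr_const cS.
have -> : (1 / 4 : R) = 1 / 2 * (1 / 2) by lra.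
rewrite -[X in X <= _]mulr_natl natrX exprMn mulrA -exprMn.
by rewrite (_ : 2 * (1 / 2) = 1) ?expr1n ?mul1r//; lra.
Qed.

End close_bounds.

(** Chernoff's method: the untreated count has expected weight [2 ^ (- count)] equal to
    [(1 - q / 2) ^+ n]. *)
Lemma untreated_bound (q : R) : 0 < q -> (forall i, P (D i @^-1` [set false])
  = q%:E) ->
  exists2 N, (0 < N)%N & exists2 rate, 0 < rate < 1 & forall n,
    (P [set w | (N * #|[set i : 'I_n | ~~ D i w]%SET| <= n)%N] <= (rate ^+ n)%:E)%E.
Proof.
move=> q0 Dq.
have q1 : q <= 1.
  by rewrite -lee_fin -(Dq 0); apply: probability_le1; exact: measurable_treatment.
(* The choice makes [s * (1 - q / 2) = 1 - (q / 2) ^+ 2 < 1], while [s > 1] still lets Bernoulli's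
   inequality give [s ^+ N >= 2]. *)
pose s := 1 + q / 2; have s1 : 1 <= s by rewrite lerDl divr_ge0// ltW.
have [N N0 sN] : exists2 N, (0 < N)%N & 2 <= s ^+ N.
  pose N := (Num.bound (2 / q)).+1; exists N => //.
  have bern k : 1 + k%:R * (q / 2) <= s ^+ k.
    elim: k => [|k IH]; first by rewrite mul0r addr0 expr0.
    rewrite exprS (le_trans _ (ler_wpM2l _ IH))//; last by rewrite (le_trans ler01).
    rewrite /s -natr1; have : 0 <= k%:R * (q / 2) * (q / 2).
      by have q20 : 0 <= q / 2 by [rewrite divr_ge0// ltW]; rewrite mulr_ge0//
        mulr_ge0.
    by lra.
  apply: le_trans (bern N).
  have : 2 / q < N%:R.
    apply: (lt_le_trans (archi_boundP _)); first by rewrite divr_ge0// ltW.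
    by rewrite ler_nat leqnSn.
  by rewrite ltr_pdivrMr// => h; lra.
exists N => //; exists (1 - q / 2 * (q / 2)).
  by apply/andP; split; nra.
move=> n.
have DqC i : P (D i @^-1` [set true]) = (1 - q)%:E.
  rewrite EFinB -(Dq i) -probability_setC; last exact: measurable_treatment.
  by congr (P _); apply/seteqP; split=> w /=; case: (D i w).
pose patt (S : {set 'I_n}) := [set w | forall i : 'I_n, D i w = (i \notin S)].
have mpatt S : measurable (patt S).
  by apply: measurable_fin_forall => i; exact: measurable_treatment.
have Ppatt S : P (patt S) = (\prod_(i < n) if i \in S then q else 1 - q)%:E.
  pose A (k : nat) : set bool :=
    if insub k is Some i then [set i \notin S] else setT.
  have AE (i : 'I_n) : A i = [set i \notin S] by rewrite /A valK.
  have := indD (iota_uniq 0 n) (A := A) (fun j => Logic.I).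
  rewrite (_ : \bigcap_(j in _) _ = patt S); last first.
    apply/seteqP; split=> w h => [i|j /=].
      by have := h i; rewrite /preimage/= AE mem_iota/= add0n ltn_ord; exact.
    rewrite mem_iota add0n /= => jn; rewrite -[j]/(val (Ordinal jn)) AE.
    exact: h.
  move=> ->; rewrite -[X in iota _ X]subn0 big_mkord (big_morph _ EFinM erefl).
  by apply: eq_bigr => i _; rewrite AE; case: (i \in S).
apply: (le_trans (@fin_union_bound _ _ _ R P (fun S : {set 'I_n} => (N * #|S| <= n)%N) _
  patt _ mpatt _)).
- apply: (measurable_random_set (B := fun w => [set i : 'I_n | ~~ D i w]%SET)
    (fun S => (N * #|S| <= n)%N)) => i.
  rewrite (_ : [set w | _] = [set w | D i w = false]);
    first exact: measurable_treatment.
  by apply/seteqP; split=> w /=; rewrite inE; case: (D i w).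
- by move=> w Nn; exists [set i : 'I_n | ~~ D i w]%SET => // i; rewrite inE negbK.
rewrite (eq_bigr _ (fun S _ => Ppatt S)) sumEFin lee_fin.
(* On the event, [2 ^ #|S| <= s ^+ (N * #|S|) <= s ^+ n], so inserting the weight
   [s ^+ n / 2 ^ #|S|] only enlarges the sum. *)
apply: (@le_trans _ _ (\sum_(S : {set 'I_n}) s ^+ n *
    \prod_(i < n) if i \in S then q / 2 else 1 - q)).
  rewrite big_mkcond/=; apply: ler_sum => S _.
  have p0 (c : R) : 0 <= c -> 0 <= \prod_(i < n) if i \in S then c else 1 - q.
    by move=> c0; apply: prodr_ge0 => i _; case: ifP => // _; rewrite subr_ge0.
  case: ifP => NS; last by rewrite mulr_ge0 ?p0 ?exprn_ge0 ?divr_ge0 ?(le_trans ler01 s1)// ltW.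
  have -> : \prod_(i < n) (if i \in S then q / 2 else 1 - q) =
      2^-1 ^+ #|S| * \prod_(i < n) if i \in S then q else 1 - q.
    have -> : 2^-1 ^+ #|S| = \prod_(i < n) (if i \in S then 2^-1 else 1 : R).
      by rewrite -big_mkcond/= prodr_const.
    rewrite -big_split/=; apply: eq_bigr => i _.
    by case: ifP => _; rewrite ?mul1r// mulrC.
  rewrite mulrA ler_peMl ?p0 ?(ltW q0)// exprVn ler_pdivlMr ?exprn_gt0// mul1r.
  apply: (@le_trans _ _ ((s ^+ N) ^+ #|S|));
    first by rewrite lerXn2r ?nnegrE ?exprn_ge0 ?(le_trans ler01 s1).
  by rewrite -exprM ler_weXn2l.
(* The sum over subsets is the expansion of [(q / 2 + (1 - q)) ^+ n]. *)
rewrite -mulr_sumr -(bigA_distr 1 _ (fun=> q / 2) (fun=> 1 - q))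
  prodr_const card_ord -exprMn.
rewrite (_ : s * _ = 1 - q / 2 * (q / 2))//= /s; by field.
Qed.

Definition isolated_untreated (rho : R) (n : nat) (w : T) : {set 'I_n} :=
  [set i : 'I_n | ~~ D i w] :\: crowded rho n w.

Lemma isolatedP rho n w i : i \in isolated_untreated rho n w -> ~~ D i w /\
  forall j : 'I_n, D j w || (j < i)%N -> ~~ box_close rho (X i w) (X j w).
Proof.
rewrite !inE => /andP[+ Di]; rewrite Di/= negb_exists => /forallP h.
by split=> // j Dj; have := h j; rewrite Dj.
Qed.

(** Borel-Cantelli: almost surely, for large [n], more than [n / N] points are untreated and fewer
    than [n / (2 N)] are crowded, which leaves more than [n / (2 N)] isolated ones. *)
Lemma isolated_eventually (N : nat) (rate : R) (rho kappa : nat -> R) :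
  (0 < N)%N -> 0 < rate < 1 ->
  (forall n, (P [set w | (N * #|[set i : 'I_n | ~~ D i w]%SET| <= n)%N] <= (rate ^+ n)%:E)%E) ->
  (forall n m x, (P (X m @^-1` [set y | box_close (rho n) y x])
    <= (kappa n)%:E)%E) ->
  (forall n, n%:R * kappa n <= (1 / 4) ^+ (2 * N)) ->
  {ae P, forall w, \forall n \near \oo, (n < 2 * N * #|isolated_untreated (rho n) n w|)%N}.
Proof.
move=> N0 /andP[rate0 rate1] Urate Pclose nkappa.
pose U n := [set w | (N * #|[set i : 'I_n | ~~ D i w]%SET| <= n)%N].
pose B n := [set w | (n <= 2 * N * #|crowded (rho n) n w|)%N].
have mU n : measurable (U n).
  apply: (measurable_random_set (B := fun w => [set i : 'I_n | ~~ D i w]%SET)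
    (fun S => (N * #|S| <= n)%N)) => i.
  rewrite (_ : [set w | _] = [set w | D i w = false]);
    first exact: measurable_treatment.
  by apply/seteqP; split=> w /=; rewrite inE; case: (D i w).
have mB n : measurable (B n).
  apply: (measurable_random_set (B := crowded (rho n) n)
    (fun S => (n <= 2 * N * #|S|)%N)).
  exact: measurable_crowded.
pose F n := U n `|` B n.
have mF n : measurable (F n) by exact: measurableU.
have PF n : (P (F n) <= (geometric 1 rate n + geometric 1 (1 / 2) n)%:E)%E.
  apply: (le_trans (measureU2 _ _ _)) => //; rewrite EFinD /= !mul1r leeD//;
    first exact: Urate.
  by rewrite -div1r; apply: (crowded_bound (Pclose n)) => //; rewrite muln_gt0.
have sF : (\sum_(0 <= n <oo) P (F n) < +oo)%E.
  apply: (@le_lt_trans _ _ (1 / (1 - rate) + 1 / (1 - 1 / 2))%:E); last exact: ltry.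
  apply: lime_le; first by apply: is_cvg_nneseries => n _ _; exact: measure_ge0.
  apply: nearW => n.
  apply: (le_trans (lee_sum _ (fun i _ => PF i))).
  rewrite sumEFin lee_fin big_split/= lerD//.
    by apply: geometric_le_lim => //; rewrite gtr0_norm.
  by apply: geometric_le_lim => //; rewrite gtr0_norm; lra.
exists (lim_sup_set F); split.
- by apply: bigcap_measurable => // k _; apply: bigcup_measurable.
- exact: lim_sup_set_cvg0.
move=> w; apply: contra_notP => /existsNP[n0 /not_implyP[_ nF]].
exists n0 => // n /= n0n; apply: contra_notP nF => h.
exists n => //; apply: contrapT => /not_orP[/negP + /negP].
rewrite -!ltnNge => Un Bn; apply: h.
have cI : (#|[set i : 'I_n | ~~ D i w]%SET| <= #|isolated_untreated (rho n)
  n w| + #|crowded (rho n) n w|)%N.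
  rewrite -(cardsID (crowded (rho n) n w) [set i : 'I_n | ~~ D i w]%SET) addnC.
  by rewrite leq_add2l subset_leq_card// subsetIr.
have {}cI := leq_mul (leqnn N) cI; rewrite mulnDr in cI.
move: Un Bn cI; rewrite -!mulnA.
by move: (N * _)%N (N * _)%N (N * _)%N => a b k; lia.
Qed.

End sample_bounds.

(** In each treatment arm the density is bounded and the sup-norm ball has Lebesgue measure
    [(2 * rho) ^+ p]; the two arms add up. *)
Lemma density_close_bound (R : realType) (p : nat) d (T : measurableType d)
    (P : probability T R) (X : {mfun T >-> p.-tuple R}) (D : {mfun T >-> bool}) :
  bounded_conditional_density P X D ->
  exists2 M : R, 0 <= M & forall rho x, 0 < rho ->
    (P (X @^-1` [set y | box_close rho y x]) <= (M * (2 * rho) ^+ p)%:E)%E.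
Proof.
move=> dens.
have /choice[M HM] : forall b, exists M : R, 0 <= M /\ forall rho x, 0 < rho ->
    (P (X @^-1` [set y | box_close rho y x] `&` D @^-1` [set b])
      <= (M * (2 * rho) ^+ p)%:E)%E.
  move=> b; have [g [mg g0 [M gM] gE]] := dens b.
  have M0 : 0 <= M by apply: le_trans (gM [tuple 0 | i < p]).
  exists M; split => // rho x rho0.
  pose A := [set y : p.-tuple R | box_close rho y x].
  pose I (j : 'I_p) := `[tnth x j - rho, tnth x j + rho]%classic.
  have AE : A = [set y | forall j, I j (tnth y j)].
    by apply/seteqP; split=> y /= => [/forallP|] h; [|apply/forallP];
      move=> j; have := h j; rewrite /I/= in_itv/= ler_distl.
  have mA : measurable A by rewrite AE; apply: measurable_box => j;
    exact: measurable_itv.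
  have lA : lebesgue_tuple R p A = ((2 * rho) ^+ p)%:E.
    rewrite AE lebesgue_tuple_box; last by move=> j; exact: measurable_itv.
    rewrite (eq_bigr (fun=> (2 * rho)%:E)) => [|j _].
      by rewrite -(big_morph _ (@EFinM R) erefl) prodr_const card_ord.
    rewrite /lebesgueR /I lebesgue_measure_itv/= lte_fin.
    rewrite ltrD2l gtrN// -EFinD; congr EFin; lra.
  rewrite (gE _ mA).
  have gint : (\int[lebesgue_tuple R p]_(y in A) (g y)%:E <= (M * (2 * rho)
    ^+ p)%:E)%E.
    rewrite EFinM -lA -(integral_cst (lebesgue_tuple R p) mA).
    apply: ge0_le_integral => //.
    - by move=> y _; rewrite lee_fin.
    - by apply/measurable_EFinP; exact: (measurable_funS measurableT).
    - by move=> y _; rewrite lee_fin.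
  rewrite -[leRHS]mul1e lee_pmul//.
  - by apply: integral_ge0 => y _; rewrite lee_fin.
  - apply: probability_le1; rewrite -[X in measurable X]setTI.
    exact: (@measurable_funPT _ _ _ _ D).
exists (M true + M false); first by rewrite addr_ge0//; have [] := HM true;
  have [] := HM false.
move=> rho x rho0; pose A := [set y : p.-tuple R | box_close rho y x].
have mA : measurable (X @^-1` A) by apply: measurable_close => //;
  exact: measurable_cst.
have mD b : measurable (D @^-1` [set b]).
  by rewrite -[X in measurable X]setTI; exact: (@measurable_funPT _ _ _ _ D).
rewrite (_ : X @^-1` A = (X @^-1` A `&` D @^-1` [set true])
  `|` (X @^-1` A `&` D @^-1` [set false])); last first.
  rewrite -setIUr; apply/seteqP; split=> w /=; last by case.
  by move=> Aw; split => //; case: (D w); [left|right].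
rewrite mulrDl EFinD; apply: (le_trans (measureU2 _ _ _));
  [exact: measurableI|exact: measurableI|].
by apply: leeD; [have [_] := HM true|have [_] := HM false]; exact.
Qed.

Lemma far_norm (R : realType) (p : nat) (rho : R) (x y : p.-tuple R) :
  ~~ box_close rho x y -> rho < `|row_of_tuple x - row_of_tuple y|.
Proof.
rewrite negb_forall => /existsP[k]; rewrite -ltNge => /lt_le_trans; apply.
rewrite [leRHS]mx_normrE; have := @le_bigmax _ _ _ 0
  (fun i : 'I_1 * 'I_p => `|(row_of_tuple x - row_of_tuple y) i.1 i.2|) (ord0, k).
by rewrite /= !mxE.
Qed.

Lemma le_limn_einf_near (R : realType) (u v : (\bar R)^nat) :
  (\forall n \near \oo, (u n <= v n)%E) -> (limn_einf u <= limn_einf v)%E.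
Proof.
move=> [n0 _ uv]; rewrite !limn_einf_lim; apply: lee_lim.
- exact: is_cvg_einfs.
- exact: is_cvg_einfs.
exists n0 => // n /= n0n; apply: le_ereal_inf_tmp => _ [k /= nk <-].
apply: le_trans (uv k (leq_trans n0n nk)).
by apply: ereal_inf_lbound; exists k.
Qed.

Lemma exists_small_radius (R : realType) (p : nat) (M c : R) : (0 < p)%N ->
  0 <= M -> 0 < c <= 1 -> exists2 eps, 0 < eps & M * (4 * eps) ^+ p <= c.
Proof.
move=> p0 M0 /andP[c0 c1]; have M1 : 0 < M + 1 by rewrite ltr_wpDl.
(* Then [4 * eps <= 1], so its [p]-th power is at most itself. The 4 matches the side [2 * (2 * r)]
   of a box of radius [2 * r]. *)
exists (c / (M + 1) / 4); first by rewrite !divr_gt0.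
rewrite (_ : 4 * _ = c / (M + 1)); last by field; rewrite gt_eqF.
have cM0 : 0 <= c / (M + 1) by rewrite divr_ge0// ltW.
have cM1 : c / (M + 1) <= 1 by rewrite ler_pdivrMr// mul1r (le_trans c1)// lerDr.
apply: (@le_trans _ _ (M * (c / (M + 1)))).
  by rewrite ler_wpM2l//; case: p p0 => // k _; rewrite exprS ler_piMr// exprn_ile1.
rewrite [leLHS](_ : _ = c * (M / (M + 1))); last by field; rewrite gt_eqF.
by rewrite ler_piMr ?(ltW c0)// ler_pdivrMr// mul1r lerDl.
Qed.

(** * The perturbation that the data cannot distinguish from zero *)

Section least_favorable.
Context (R : realType) (p : nat).

(** The treated regression function is lowered around the points of [G], which are to be untreated
    points far from every treated one. *)
Definition dip n (z : n.-tuple (p.-tuple R * bool)) (G : {set 'I_n}) (r A : R) N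
    : 'rV[R]_p -> bool -> R :=
  fun x b => if b then scaled_sum (fun i => row_of_tuple (tnth z i).1) G r (- A)
    (@ball_bump R p N) x
             else 0.

Variables (n : nat) (z : n.-tuple (p.-tuple R * bool)) (G : {set 'I_n}).
Variables (r A : R) (N : nat).
Hypotheses (r0 : 0 < r) (A0 : 0 <= A) (N0 : (0 < N)%N).
Hypothesis far : forall i, i \in G -> ~~ (tnth z i).2 /\
  forall j : 'I_n, (tnth z j).2 || (j < i)%N ->
    ~~ box_close (2 * r) (tnth z i).1 (tnth z j).1.

Let c i := row_of_tuple (tnth z i).1.

(** Of two points of [G], the later is far from the earlier. *)
Lemma dip_separated : {in G &, forall i k, i != k -> 2 * r < `|c i - c k|}.
Proof.
move=> i k iG kG; rewrite -val_eqE/= neq_ltn => /orP[ik|ki].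
  have [_ h] := far kG; rewrite distrC; apply: far_norm.
  by apply: h; rewrite ik orbT.
have [_ h] := far iG; apply: far_norm.
by apply: h; rewrite ki orbT.
Qed.

(** A treated sample point is farther than [2 * r] from every centre, hence outside all bumps; at
    [d = 0] the function is zero by definition. *)
Lemma sample_dip e : sample (dip z G r A N) z e = sample (fun _ _ => 0) z e.
Proof.
apply: eq_mktuple => i; congr (_ + _, _); rewrite /at_design /dip.
case Di : (tnth z i).2 => //; rewrite /scaled_sum big1// => k _; case: ifP => // kG.
rewrite bump_out ?mulr0// normrZ gtr0_norm ?invr_gt0// ltr_pdivlMl// mulr1.
have [_ /(_ i)] := far kG; rewrite Di => /(_ isT) /far_norm; rewrite distrC.
by apply: lt_trans; rewrite mulr_natl mulr2n ltrDl.
Qed.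

(** Each point of [G] sees the full depth [A] of its own bump, and all other contributions are
    nonpositive. *)
Lemma average_effect_dip :
  average_effect (dip z G r A N) z <= - A * #|G|%:R / n%:R.
Proof.
rewrite /average_effect mulrC ler_wpM2r ?invr_ge0//.
rewrite (@le_trans _ _ (\sum_(i < n) if i \in G then - A else 0))//; last first.
  by rewrite -big_mkcond/= sumr_const mulr_natr.
apply: ler_sum => i _; rewrite /dip subr0 /scaled_sum.
have le0 (k : 'I_n) : (if k \in G then - A * ball_bump N (r^-1 *: (c i - c k))
  else 0) <= 0.
  by case: ifP => // _; rewrite mulNr oppr_le0 mulr_ge0// bump_ge0.
case: ifPn => [iG|_]; last by apply: sumr_le0 => k _; exact: le0.
rewrite (bigD1 i)//= iG subrr scaler0 bump0 mulr1 gerDl.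
by apply: sumr_le0 => k _; exact: le0.
Qed.

End least_favorable.

(** * From coverage under the perturbation to the bound under the zero function *)

Theorem theorem4p1 (R : realType) (p : nat) (hp : (0 < p)%N)
    (d : measure_display) (T : measurableType d) (P : probability T R)
    (X : nat -> {RV P >-> p.-tuple R}) (D : nat -> {RV P >-> bool})
    (u : nat -> {RV P >-> R})
    (sigma2 : 'rV[R]_p -> bool -> R) (hsigma2 : forall x b, 0 <= sigma2 x b)
    (K : forall n : nat,
       R.-pker (n.-tuple (p.-tuple R * bool)%type) ~> (n.-tuple R))
    (* the covariates and treatments *)
    (hiid : iid P (fun i w => (X i w, D i w)))
    (hD : forall i, P (D i @^-1` [set true]) != 0%E /\
                    P (D i @^-1` [set true]) != 1%E)
    (hX : forall i, bounded_conditional_density P (X i) (D i))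
    (* the errors, conditional on the covariates and treatments *)
    (hK : forall n, regular_conditional_law P (errors u n) (design X D n) (K n))
    (hu : forall n, {ae P, forall w,
       normal_errors (K n (design X D n w)) (at_design sigma2 (design X D n w))})
    (alpha gamma C : R) (halpha : 0 < alpha < 1) (hgamma : 0 < gamma)
    (hC : 0 < C)
    (* the confidence intervals *)
    (chat : forall n : nat, n.-tuple (R * (p.-tuple R * bool))%type -> R)
    (hchat : forall n, measurable_fun setT (chat n))
    (hcoverage : {ae P, forall w,
       ((1 - alpha)%:E <= limn_einf (fun n =>
          ereal_inf [set cond_prob (K n) f
                       [set y | average_effect f (design X D n w)
                                  \in `[chat n y, +oo[ ]
                       (design X D n w)
                    | f in [set f | forall b, hoelder_class gamma C (f^~ b)]]))%E}) :
  exists eta : R, 0 < eta /\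
    {ae P, forall w,
       ((1 - alpha)%:E <= limn_einf (fun n =>
          cond_prob (K n) (fun _ _ => 0%R)
            [set y | (chat n y <= - eta * n%:R `^ (- gamma / p%:R))%R]
            (design X D n w)))%E}.
Proof.
have [indXD idXD] := hiid.
pose q := fine (P (D 0 @^-1` [set false])).
have mDb i b : measurable (D i @^-1` [set b]) by exact: measurable_treatment.
have Dq i : P (D i @^-1` [set false]) = q%:E.
  rewrite /q fineK ?fin_num_measure//.
  have := idXD i 0%N _ (measurableX (measurableT : measurable [set: p.-tuple R])
    (Logic.I : measurable [set false])).
  by congr (P _ = P _); apply/seteqP; split=> w /=; [case|split|case|split].
have q0 : 0 < q.
  rewrite -lte_fin -(Dq 0%N) lt0e measure_ge0 andbT.
  apply: contra_neqN (hD 0%N).2 => /eqP Df.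
  have -> : D 0 @^-1` [set true] = ~` (D 0 @^-1` [set false]).
    by apply/seteqP; split=> w /=; case: (D 0 w).
  by rewrite probability_setC// Df sube0.
have [N N0 [rate rate01 Urate]] := untreated_bound indXD q0 Dq.
have [M M0 Mclose] := density_close_bound (hX 0).
have [|eps eps0 Meps] := @exists_small_radius R p M ((1 / 4) ^+ (2 * N)) hp M0.
  by rewrite exprn_gt0//= exprn_ile1//; lra.
have [a a0 [Nb Nb0 hcl]] := @hoelder_scaled_sum R p gamma C hgamma hC.
pose r (n : nat) := eps * n%:R `^ (- 1 / p%:R).
have r0 n : (0 < n)%N -> 0 < r n by move=> n0; rewrite mulr_gt0// powR_gt0// ltr0n.
have pR0 : p%:R != 0 :> R by rewrite pnatr_eq0 -lt0n.
(* The density bound asks for a positive radius; at [n = 0] the trivial bound 1 serves, as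
   [n * kappa n] is then 0. *)
pose kappa (n : nat) : R := if n is 0 then 1 else M * (2 * (2 * r n)) ^+ p.
have Pclose n m x : (P (X m @^-1` [set y | box_close (2 * r n) y x])
  <= (kappa n)%:E)%E.
  case: n => [|n].
    apply: probability_le1; apply: measurable_close => //; exact: measurable_cst.
  have <- : P (X 0 @^-1` [set y | box_close (2 * r n.+1) y x]) =
            P (X m @^-1` [set y | box_close (2 * r n.+1) y x]).
    have mc : measurable [set y : p.-tuple R | box_close (2 * r n.+1) y x].
      by apply: measurable_close => //; exact: measurable_cst.
    have := idXD 0%N m _ (measurableX mc (measurableT : measurable [set: bool])).
    by congr (P _ = P _); apply/seteqP; split=> w /=; [case|split|case|split].
  by apply: Mclose; rewrite mulr_gt0// r0.
(* The power [n ^ (-1/p)] is tuned so that [n] cancels, leaving [M * (4 * eps) ^+ p]. *)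
have nkappa n : n%:R * kappa n <= (1 / 4) ^+ (2 * N).
  case: n => [|n]; first by rewrite mul0r exprn_ge0.
  rewrite /kappa (_ : 2 * (2 * r n.+1) = (4 * eps) * n.+1%:R `^ (- 1 / p%:R));
    last by rewrite /r; ring.
  rewrite exprMn -(powR_mulrn p (powR_ge0 _ _)) -powRrM divfK// powR_inv1//.
  have n1 : n.+1%:R != 0 :> R by rewrite pnatr_eq0.
  by rewrite mulrC -!mulrA mulVf// mulr1.
have iso := isolated_eventually indXD N0 rate01 Urate Pclose nkappa.
(* The depth [a * r n ^ gamma] times the guaranteed fraction [1 / (2 N)] of isolated points, with
   the power of [n] removed. *)
exists (a * eps `^ gamma / (2 * N)%:R); split.
  by rewrite divr_gt0 ?mulr_gt0 ?powR_gt0// ltr0n muln_gt0.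
apply: filterS2 hcoverage iso => w cov isow; apply: (le_trans cov).
apply: le_limn_einf_near; near=> n.
have n0 : (0 < n)%N by near: n; exists 1%N.
set z := design X D n w; set G := isolated_untreated X D (2 * r n) n w.
have Gn : (n < 2 * N * #|G|)%N by rewrite /G; near: n.
have zE i : tnth z i = (X i w, D i w) by rewrite tnth_mktuple.
have far i : i \in G -> ~~ (tnth z i).2 /\
  forall j : 'I_n, (tnth z j).2 || (j < i)%N ->
    ~~ box_close (2 * r n) (tnth z i).1 (tnth z j).1.
  by move=> /isolatedP[Di h]; rewrite zE; split=> // j; rewrite zE; exact: h.
pose A := a * r n `^ gamma.
have A0 : 0 <= A by rewrite mulr_ge0 ?powR_ge0// ltW.
(* This [f] depends on [w] through the design, as is allowed: the infimum in the coverage is taken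
   with the design fixed. *)
pose f := dip z G (r n) A Nb.
have fH b : hoelder_class gamma C (f^~ b).
  case: b; last exact: hoelder_class0.
  by apply: hcl; [exact: r0|exact: dip_separated].
apply: (@le_trans _ _ (cond_prob (K n) f
    [set y | average_effect f z \in `[chat n y, +oo[ ] z)).
  by apply: ereal_inf_lbound; exists f.
have fE e : sample f z e = sample (fun _ _ => 0) z e by apply: sample_dip => //;
  exact: r0.
have ms : measurable_fun setT (sample (fun (_ : 'rV[R]_p) _ => 0)
  z : n.-tuple R -> _).
  apply/measurable_fun_tnthP => i.
  rewrite (_ : _ \o _ = fun e : n.-tuple R => (0 + tnth e i, tnth z i)); last first.
    by apply/funext => e /=; rewrite tnth_mktuple.
  apply: measurable_fun_pair; last exact: measurable_cst.
  by apply: measurable_funD; [exact: measurable_cst|exact: measurable_tnth].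
have mc (c : R) : measurable [set e | chat n (sample (fun _ _ => 0) z e) <= c].
  have := (measurableT_comp (hchat n) ms)
    measurableT `]-oo, c]%classic (measurable_itv _).
  by rewrite setTI; congr measurable; apply/seteqP; split=> e /=; rewrite in_itv.
have Lf : average_effect f z <= - (a * eps `^ gamma / (2 * N)%:R)
  * n%:R `^ (- gamma / p%:R).
  apply: (@le_trans _ _ (- A * #|G|%:R / n%:R)); first exact: average_effect_dip.
  have rg : r n `^ gamma = eps `^ gamma * n%:R `^ (- gamma / p%:R).
    rewrite /r powRM ?powR_ge0 ?(ltW eps0)// -powRrM; congr (_ * _ `^ _).
    by rewrite mulrAC mulN1r.
  rewrite /A rg !mulNr lerN2 -!mulrA ler_wpM2l ?(ltW a0)// ler_wpM2l ?powR_ge0//.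
  rewrite [leLHS]mulrC ler_wpM2l ?powR_ge0//.
  rewrite ler_pdivlMr ?ltr0n// mulrC ler_pdivrMr ?ltr0n ?muln_gt0//.
  by rewrite -natrM ler_nat mulnC ltnW.
rewrite /cond_prob.
(* Since the samples coincide, coverage of [L f] under [f] is the event that the bound computed from
   the zero-function data is at most [L f]. *)
rewrite (_ : [set e | _] = [set e | chat n (sample (fun _ _ => 0) z e)
  <= average_effect f z]); last first.
  by apply/seteqP; split=> e /=; rewrite fE in_itv/= andbT.
apply: le_measure; rewrite ?inE; [exact: mc|exact: mc|].
by move=> e /= h; exact: le_trans h Lf.
Unshelve. all: by end_near. Qed.
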